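(* Suppose that $\mathrm{zer}(\Phi)\neq\emptyset$, $\Phi$ is $\rho$-co-hypomonotone, and $F$ is $L$-Lipschitz continuous. Fix $r>2$, $\mu>1$, $\epsilon\ge0$, $\hat\epsilon\ge0$, $\kappa\ge0$, and $$0\le\hat\kappa<\frac{3r-1}{3r(12+3r+\hat\epsilon)}.$$ Let $$\Psi:=\frac{1}{\sqrt{4+12\kappa+3\kappa r+\kappa\hat\epsilon}}\Big[1-\frac1{3r}-\hat\kappa(12+3r+\hat\epsilon)\Big]\in(0,1],$$ and suppose that $L\rho<\frac{(r-2)\Psi}{8(r+\mu-1)}$. Choose $$t_k:=k+t_0,\qquad\beta:=8\rho+2\epsilon,\qquad\frac{(r+\mu-1)\beta}{r-2}\le\eta<\bar\eta:=\frac{\Psi}{L},$$ where $t_0$ is defined in the context. Let $\{(x^k,y^k)\}$ be generated by the scheme (GAEG$_+$) described in the context with these parameters and with $u^0=Fx^0$ and directions $u^k$ satisfying, for all $k\ge1$, $$\|Fx^k-u^k\|^2\le\kappa\|Fx^k-Fy^{k-1}\|^2+\hat\kappa\|d^{k-1}\|^2.$$ Then $$\lim_{k\to\infty}k^2\|Fx^k+\xi^k\|^2=0,\qquad\lim_{k\to\infty}k^2\|x^{k+1}-x^k\|^2=0,\qquad\lim_{k\to\infty}k^2\|y^k-x^k\|^2=0.$$ That is, $\|Fx^k+\xi^k\|=o(1/k)$, $\|x^{k+1}-x^k\|=o(1/k)$, and $\|y^k-x^k\|=o(1/k)$.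
   Context: $\mathbb R^p$ carries the standard inner product and Euclidean norm. $F:\mathbb R^p\to\mathbb R^p$ is single-valued, $T:\mathbb R^p\rightrightarrows2^{\mathbb R^p}$ is set-valued, $\Phi:=F+T$, $\mathrm{zer}(\Phi)=\{x:0\in Fx+Tx\}$. For $\rho\ge0$, $\Phi$ is $\rho$-co-hypomonotone if $\langle u-v,x-y\rangle\ge-\rho\|u-v\|^2$ for all $(x,u),(y,v)\in\mathrm{gra}(\Phi)$. $F$ is $L$-Lipschitz continuous if $\|Fx-Fy\|\le L\|x-y\|$ for all $x,y$. The resolvent $J_{\eta T}$, $J_{\eta T}x=\{y:x\in y+\eta Ty\}$, is assumed to be defined on all of $\mathbb R^p$ and single-valued. Throughout $\eta>\beta\ge0$. Scheme (GAEG$_+$): start from $x^0\in\mathrm{dom}(\Phi)$, $\xi^0\in Tx^0$, $u^0:=Fx^0$, $y^{-1}=y^0:=x^0$, $d^{-1}:=0$. With $\xi^k\in Tx^k$ put $w^k:=Fx^k+\xi^k$, $\hat w^k:=Fy^{k-1}+\xi^k$, $z^k:=u^k+\xi^k$. For $k\ge0$: $$x^{k+1}:=y^k-\eta d^k,\qquad y^{k+1}:=x^{k+1}+\theta_k(x^{k+1}-x^k)-p^k,$$ $$d^k:=\hat w^{k+1}-\gamma_kz^k,\qquad p^k:=\eta_kz^{k+1}-\lambda_k\hat w^{k+1}+\nu_kz^k,$$ where the implicit definition of $x^{k+1}$ means $x^{k+1}=J_{\eta T}(y^k-\eta Fy^k+\eta\gamma_kz^k)$ and $\xi^{k+1}:=\frac1\eta(y^k-\eta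 Fy^k+\eta\gamma_kz^k-x^{k+1})\in Tx^{k+1}$. Parameters: $t_{k+1}=t_k+1$ and $$\theta_k:=\frac{t_k-r-\mu}{t_{k+1}},\quad\gamma_k:=\frac{t_k-r+1}{t_k},\quad\eta_k:=\frac{(\eta-\beta)t_k-\delta}{t_{k+1}},\quad\lambda_k:=\frac{\eta t_k}{t_{k+1}},\quad\nu_k:=\frac{\beta t_k}{t_{k+1}},$$ $$\delta:=(r-1)\beta+\frac{(r-2)(\eta-\beta)}{\mu+1},\qquad\omega:=\frac{\mu(\eta-\beta)}{\mu+1}.$$ Constants: $$t_0:=\max\Big\{\bar t_0,\ \hat t_0,\ r,\ \frac{\eta(r-1)}{\eta-\beta},\ \frac\mu\omega(r-1)[\eta-(2r+1)\omega],\ \frac{(r-2)\sqrt{\omega r}}{\sqrt{\eta(\mu-1)}}\Big\},$$ where $\bar t_0:=\frac{D+\sqrt{D^2+4\eta E}}{2\eta}$ with $D:=2\delta+\omega(r+\mu-1)^2+6r\eta+2\beta+2\hat\epsilon\eta$ and $E:=4\rho r(r-2)+3r\eta+8\rho+\hat\epsilon\eta$; and $\hat t_0:=\frac{B+\sqrt{B^2-AC}}{A}$ if $B^2\ge AC$, $\hat t_0:=0$ otherwise, with $$A:=\frac{(\eta-\beta)^2}{(\mu+1)^2}\Big(\mu-\frac1{2r}-\frac12\Big),\qquad B:=\frac{\eta-\beta}{(\mu+1)^2}\Big[\frac{(r-1)[2r\mu(\eta-\beta)-(\eta+\mu\beta)]}{2r}+\rho(\mu+1)(2r\mu-1)\Big],$$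 $$C:=(r-1)\Big\{\frac{(r-1)(\eta+\mu\beta)}{(\mu+1)^2}\Big[\Big(\mu-\frac1{2r}\Big)\eta-\frac{(2r+1)\mu\beta}{2r}\Big]-2\rho[\eta-(2r+1)\omega]\Big\}.$$ *)

(* Defs.v *)
From mathcomp Require Import all_boot all_order all_algebra.
From mathcomp Require Import all_classical all_reals all_analysis.

Set Implicit Arguments.
Unset Strict Implicit.
Unset Printing Implicit Defensive.

Import Order.TTheory GRing.Theory Num.Theory.
Import numFieldNormedType.Exports.

Local Open Scope classical_set_scope.
Local Open Scope ring_scope.

(* The library's norm on matrices is the sup norm, hence the explicit
   inner product and Euclidean norm on R^p, modelled as 'rV[R]_p. *)
Definition dotr (R : realType) (p : nat) (x y : 'rV[R]_p) : R :=
  \sum_(i < p) x 0 i * y 0 i.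

Definition enorm (R : realType) (p : nat) (x : 'rV[R]_p) : R :=
  Num.sqrt (dotr x x).

Definition lipschitz_with (R : realType) (p : nat) (L : R)
    (F : 'rV[R]_p -> 'rV[R]_p) : Prop :=
  forall x y, enorm (F x - F y) <= L * enorm (x - y).

(* A set-valued operator is a function into sets; (x, u) is in its graph
   when u \in Phi x. *)
Definition add_op (R : realType) (p : nat) (F : 'rV[R]_p -> 'rV[R]_p)
    (T : 'rV[R]_p -> set 'rV[R]_p) : 'rV[R]_p -> set 'rV[R]_p :=
  fun x => [set F x + v | v in T x].

Definition dom_op (R : realType) (p : nat)
    (Phi : 'rV[R]_p -> set 'rV[R]_p) : set 'rV[R]_p :=
  [set x | Phi x !=set0].

Definition zer (R : realType) (p : nat)
    (Phi : 'rV[R]_p -> set 'rV[R]_p) : set 'rV[R]_p :=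
  [set x | Phi x 0].

Definition cohypomonotone (R : realType) (p : nat) (rho : R)
    (Phi : 'rV[R]_p -> set 'rV[R]_p) : Prop :=
  forall x u y v, Phi x u -> Phi y v ->
    dotr (u - v) (x - y) >= - rho * enorm (u - v) ^+ 2.

Definition resolvent (R : realType) (p : nat) (eta : R)
    (T : 'rV[R]_p -> set 'rV[R]_p) (x : 'rV[R]_p) : set 'rV[R]_p :=
  [set y | exists2 v, T y v & x = y + eta *: v].

Definition resolvent_total_single_valued (R : realType) (p : nat) (eta : R)
    (T : 'rV[R]_p -> set 'rV[R]_p) : Prop :=
  forall x, exists y, resolvent eta T x = [set y].

Definition delta_par (R : realType) (r mu eta beta : R) : R :=
  (r - 1) * beta + (r - 2) * (eta - beta) / (mu + 1).

Definition omega_par (R : realType) (mu eta beta : R) : R :=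
  mu * (eta - beta) / (mu + 1).

Definition theta_ (R : realType) (r mu : R) (t : nat -> R) (k : nat) : R :=
  (t k - r - mu) / t k.+1.

Definition gamma_ (R : realType) (r : R) (t : nat -> R) (k : nat) : R :=
  (t k - r + 1) / t k.

Definition eta_ (R : realType) (r mu eta beta : R) (t : nat -> R)
    (k : nat) : R :=
  ((eta - beta) * t k - delta_par r mu eta beta) / t k.+1.

Definition lambda_ (R : realType) (eta : R) (t : nat -> R) (k : nat) : R :=
  eta * t k / t k.+1.

Definition nu_ (R : realType) (beta : R) (t : nat -> R) (k : nat) : R :=
  beta * t k / t k.+1.

Definition z_ (R : realType) (p : nat) (xi u : nat -> 'rV[R]_p)
    (k : nat) : 'rV[R]_p :=
  u k + xi k.

(* y^{k-1}, with y^{-1} = y^0. *)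
Definition y_prev (R : realType) (p : nat) (y : nat -> 'rV[R]_p)
    (k : nat) : 'rV[R]_p :=
  if k is k'.+1 then y k' else y 0.

Definition what_ (R : realType) (p : nat) (F : 'rV[R]_p -> 'rV[R]_p)
    (y xi : nat -> 'rV[R]_p) (k : nat) : 'rV[R]_p :=
  F (y_prev y k) + xi k.

Definition d_ (R : realType) (p : nat) (F : 'rV[R]_p -> 'rV[R]_p) (r : R)
    (t : nat -> R) (y xi u : nat -> 'rV[R]_p) (k : nat) : 'rV[R]_p :=
  what_ F y xi k.+1 - gamma_ r t k *: z_ xi u k.

(* d^{k-1}, with d^{-1} = 0. *)
Definition d_prev (R : realType) (p : nat) (F : 'rV[R]_p -> 'rV[R]_p) (r : R)
    (t : nat -> R) (y xi u : nat -> 'rV[R]_p) (k : nat) : 'rV[R]_p :=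
  if k is k'.+1 then d_ F r t y xi u k' else 0.

Definition p_ (R : realType) (p : nat) (F : 'rV[R]_p -> 'rV[R]_p)
    (r mu eta beta : R) (t : nat -> R) (y xi u : nat -> 'rV[R]_p)
    (k : nat) : 'rV[R]_p :=
  eta_ r mu eta beta t k *: z_ xi u k.+1
  - lambda_ eta t k *: what_ F y xi k.+1
  + nu_ beta t k *: z_ xi u k.

Definition prox_arg (R : realType) (p : nat) (F : 'rV[R]_p -> 'rV[R]_p)
    (r eta : R) (t : nat -> R) (y xi u : nat -> 'rV[R]_p)
    (k : nat) : 'rV[R]_p :=
  y k - eta *: F (y k) + (eta * gamma_ r t k) *: z_ xi u k.

(* The update x^{k+1} = y^k - eta d^k is implicit, as d^k involves xi^{k+1}:
   it stands for the resolvent step gaeg_x followed by gaeg_xi; see gaeg_stepE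
   and gaeg_xi_in below. *)
Record gaeg_plus (R : realType) (p : nat) (F : 'rV[R]_p -> 'rV[R]_p)
    (T : 'rV[R]_p -> set 'rV[R]_p) (r mu eta beta : R) (t : nat -> R)
    (x y xi u : nat -> 'rV[R]_p) : Prop := GaegPlus {
  gaeg_x0 : dom_op (add_op F T) (x 0);
  gaeg_xi0 : T (x 0) (xi 0);
  gaeg_u0 : u 0 = F (x 0);
  gaeg_y0 : y 0 = x 0;
  gaeg_x : forall k,
    resolvent eta T (prox_arg F r eta t y xi u k) = [set x k.+1];
  gaeg_xi : forall k,
    xi k.+1 = eta^-1 *: (prox_arg F r eta t y xi u k - x k.+1);
  gaeg_y : forall k,
    y k.+1 = x k.+1 + theta_ r mu t k *: (x k.+1 - x k)
             - p_ F r mu eta beta t y xi u k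
}.

Lemma gaeg_stepE (R : realType) (p : nat) (F : 'rV[R]_p -> 'rV[R]_p)
    (T : 'rV[R]_p -> set 'rV[R]_p) (r mu eta beta : R) (t : nat -> R)
    (x y xi u : nat -> 'rV[R]_p) : eta != 0 ->
  gaeg_plus F T r mu eta beta t x y xi u ->
  forall k, x k.+1 = y k - eta *: d_ F r t y xi u k.
Proof.
move=> eta0 S k.
have -> : x k.+1 = prox_arg F r eta t y xi u k - eta *: xi k.+1.
  by rewrite (gaeg_xi S) scalerA divff// scale1r subKr.
rewrite /prox_arg /d_ /what_ /= scalerBr scalerA.
by rewrite [eta *: (F _ + _)]scalerDr opprB opprD !addrA (addrAC (y k)).
Qed.

Lemma gaeg_xi_in (R : realType) (p : nat) (F : 'rV[R]_p -> 'rV[R]_p)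
    (T : 'rV[R]_p -> set 'rV[R]_p) (r mu eta beta : R) (t : nat -> R)
    (x y xi u : nat -> 'rV[R]_p) : eta != 0 ->
  gaeg_plus F T r mu eta beta t x y xi u -> forall k, T (x k) (xi k).
Proof.
move=> eta0 S [|k]; first exact: gaeg_xi0 S.
have : [set x k.+1] (x k.+1) by [].
rewrite -(gaeg_x S) => -[v Tv]; rewrite (gaeg_xi S) => ->.
by rewrite addrAC subrr add0r scalerA mulVf// scale1r.
Qed.

Definition Dconst (R : realType) (r mu eta beta epsh : R) : R :=
  let delta := delta_par r mu eta beta in
  let omega := omega_par mu eta beta in
  2 * delta + omega * (r + mu - 1) ^+ 2 + 6 * r * eta + 2 * beta
  + 2 * epsh * eta.

Definition Econst (R : realType) (rho r eta epsh : R) : R :=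
  4 * rho * r * (r - 2) + 3 * r * eta + 8 * rho + epsh * eta.

Definition tbar0 (R : realType) (rho r mu eta beta epsh : R) : R :=
  let D := Dconst r mu eta beta epsh in
  let E := Econst rho r eta epsh in
  (D + Num.sqrt (D ^+ 2 + 4 * eta * E)) / (2 * eta).

Definition Aconst (R : realType) (r mu eta beta : R) : R :=
  (eta - beta) ^+ 2 / (mu + 1) ^+ 2 * (mu - 1 / (2 * r) - 1 / 2).

Definition Bconst (R : realType) (rho r mu eta beta : R) : R :=
  (eta - beta) / (mu + 1) ^+ 2 *
  ((r - 1) * (2 * r * mu * (eta - beta) - (eta + mu * beta)) / (2 * r)
   + rho * (mu + 1) * (2 * r * mu - 1)).

Definition Cconst (R : realType) (rho r mu eta beta : R) : R :=
  let omega := omega_par mu eta beta in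
  (r - 1) *
  ((r - 1) * (eta + mu * beta) / (mu + 1) ^+ 2 *
     ((mu - 1 / (2 * r)) * eta - (2 * r + 1) * mu * beta / (2 * r))
   - 2 * rho * (eta - (2 * r + 1) * omega)).

Definition that0 (R : realType) (rho r mu eta beta : R) : R :=
  let A := Aconst r mu eta beta in
  let B := Bconst rho r mu eta beta in
  let C := Cconst rho r mu eta beta in
  if A * C <= B ^+ 2 then (B + Num.sqrt (B ^+ 2 - A * C)) / A else 0.

Definition t0_par (R : realType) (rho r mu eta beta epsh : R) : R :=
  let omega := omega_par mu eta beta in
  \big[Num.max/tbar0 rho r mu eta beta epsh]_(s <-
     [:: that0 rho r mu eta beta;
         r;
         eta * (r - 1) / (eta - beta);
         mu / omega * (r - 1) * (eta - (2 * r + 1) * omega);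
         (r - 2) * Num.sqrt (omega * r) / Num.sqrt (eta * (mu - 1))]) s.

Definition Psi_par (R : realType) (r epsh kappa kappah : R) : R :=
  1 / Num.sqrt (4 + 12 * kappa + 3 * kappa * r + kappa * epsh)
  * (1 - 1 / (3 * r) - kappah * (12 + 3 * r + epsh)).

(* Main.v *)
Require Import Defs.
From mathcomp Require Import all_boot all_order all_algebra.
From mathcomp Require Import all_classical all_reals all_analysis.
From mathcomp Require Import ring lra.

Set Implicit Arguments.
Unset Strict Implicit.
Unset Printing Implicit Defensive.

Import Order.TTheory GRing.Theory Num.Theory.
Import numFieldNormedType.Exports.

Local Open Scope classical_set_scope.
Local Open Scope ring_scope.

(** Write w^k = F x^k + xi^k, b = eta - beta, om = mu b / (mu + 1) and
    V^k = t_k (x^{k+1} - x^k + eta hat w^{k+1} - beta z^k). The parameters are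
    such that the scheme reads
      V^{k+1} = V^k - (r + mu) (x^{k+1} - x^k) - (r - 2) om z^{k+1},
    which discretises V = t (x' + b w), V' = - (r + mu) x' - (r - 2) om w.
    For this flow and a solution taken as the origin, the energy
      |r x + V|^2 / 2 + r mu |x|^2 / 2 - om t <w, V> + om b t^2 |w|^2 / 2
    has the derivative
      - r (r - 2) om <x, w> - om t^2 <x', w'>
      - t (mu |x'|^2 + (r - 2) om (b - om) |w|^2),
    since (mu + 1) om = mu b cancels the product <x', w>. The first two terms
    have a sign up to the co-hypomonotonicity defect, and the energy is
    nonnegative for large t because om < b.

    In discrete time co-hypomonotonicity costs rho t^2 |w^{k+1} - w^k|^2, paid by
    beta >= 8 rho (hypomonotone_slack). Evaluating F at y^k brings the error
    f^k = hat w^{k+1} - w^{k+1}, and the directions u^k bring e^k = z^k - w^k.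
    Lipschitz continuity and L eta < Psi bound both by d^k, in the form
    4 |f^k|^2 + 18 |e^{k+1}|^2 <= |d^k|^2, and the discrete energy dissipates
    |hat w^{k+1} - w^k|^2, which is comparable to |d^k|^2, at order t^2
    (fast_dissipation). Every other term is of lower order
    in t, hence absorbed for k large (energy_decrease); as the conclusions are
    limits, only large k matters. Therefore t_k^2 (|f|^2 + |g|^2 + |e|^2) and
    t_k (|x^{k+1} - x^k|^2 + |w^{k+1}|^2) are summable, where
    g = hat w^{k+1} - z^k.

    To pass from summability to o(1/k), observe that |V^k|^2 and the coupling
    t <w, V> - b t^2 |w|^2 / 2 are nondecreasing up to summable errors, and are
    summable after division by t_k. As the series of 1 / t_k diverges, both tend
    to 0 (quasi_nondecreasing_cvg0). Then t_k |w^k| tends to 0 by completing a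
    square, and x^{k+1} - x^k and y^k - x^k are combinations of V^k / t_k,
    w^{k+1} and the errors. *)

(** * Quadratic estimates in one coordinate *)

(** Cauchy-Schwarz inequality in dimension 3. *)
Lemma sqr_lin3_le (R : realFieldType) (p q s a b c : R) :
  (p * a + q * b + s * c) ^+ 2
  <= (p ^+ 2 + q ^+ 2 + s ^+ 2) * (a ^+ 2 + b ^+ 2 + c ^+ 2).
Proof.
rewrite -subr_ge0.
have -> : (p ^+ 2 + q ^+ 2 + s ^+ 2) * (a ^+ 2 + b ^+ 2 + c ^+ 2)
  - (p * a + q * b + s * c) ^+ 2
  = (p * b - q * a) ^+ 2 + (p * c - s * a) ^+ 2 + (q * c - s * b) ^+ 2 by ring.
by rewrite !addr_ge0// sqr_ge0.
Qed.

(** With h = w^{k+1} - w^k and e = z^k - w^k this is where beta pays for the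
    lack of monotonicity: of the term beta/2 h^2 gained from the correction
    - beta z^k, a quarter covers the co-hypomonotonicity defect rho h^2 and the
    rest absorbs the cross term with e. *)
Lemma hypomonotone_slack (R : realFieldType) (beta rho h e : R) :
  0 <= beta -> 8 * rho <= beta ->
  0 <= beta / 2 * h ^+ 2 - beta * (h * e) - rho * h ^+ 2 + beta * e ^+ 2.
Proof.
move=> beta0 hrho; set q := (X in 0 <= X).
have -> : q = beta * (3 / 8) * (h - 4 / 3 * e) ^+ 2 + beta / 3 * e ^+ 2
  + (beta / 8 - rho) * h ^+ 2 by rewrite /q; field.
by do !apply: addr_ge0; apply: mulr_ge0; rewrite ?sqr_ge0//; lra.
Qed.

(** The terms of order t^2 in the variation of the energy. The gain
    eta/2 |hat w^{k+1} - w^k|^2 = eta/2 (g + e)^2 comes with a loss eta/2 |hat w^{k+1} - w^{k+1}|^2;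
    the error estimate 4 f^2 + 18 e'^2 <= d^2 for d = d^k, which holds only
    after summation over the coordinates and is therefore kept on the left with
    a weight, turns half of the gain into control of f and of e'. *)
Lemma fast_dissipation (R : realFieldType) (om b beta rho c t : R)
    (w f g e e' eta h z : R) :
  eta = b + beta -> h = g + e - f -> z = w + f - g ->
  0 < om -> 0 < b -> 0 <= beta -> 8 * rho <= beta -> 0 < t ->
  - om * t ^+ 2 * (beta / 2 * h ^+ 2 - beta * (h * e) - rho * h ^+ 2
                   + eta / 2 * (g + e) ^+ 2 - eta / 2 * f ^+ 2)
  + 2 * om * eta * ((t + 1) ^+ 2 * e' ^+ 2 - t ^+ 2 * e ^+ 2)
  + 4 / 25 * om * eta * t ^+ 2 * ((g + c / t * z) ^+ 2 - 4 * f ^+ 2 - 18 * e' ^+ 2)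
  <= - (om * eta / 20) * t ^+ 2 * (f ^+ 2 + g ^+ 2 + e ^+ 2 + e' ^+ 2)
     + 2 * om * eta * (2 * t + 1) * e' ^+ 2
     + 4 / 5 * om * eta * c ^+ 2 * z ^+ 2.
Proof.
move=> Eeta Eh Ez om0 b0 beta0 hrho t0.
have eta0 : 0 <= eta by lra.
have tn : t != 0 by rewrite gt_eqF.
rewrite -subr_ge0.
set y := c / t * z.
have -> : 4 / 5 * om * eta * c ^+ 2 * z ^+ 2 = 4 / 5 * om * eta * t ^+ 2 * y ^+ 2.
  by rewrite /y; field.
pose q1 := beta / 2 * h ^+ 2 - beta * (h * e) - rho * h ^+ 2 + beta * e ^+ 2
  + b * e ^+ 2.
pose q2 := (g + 2 * e) ^+ 2.
pose q3 := (g - 4 * y) ^+ 2.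
set rhs := (X in 0 <= X).
have -> : rhs = om * t ^+ 2 * q1 + om * eta * t ^+ 2 / 4 * q2
  + om * eta * t ^+ 2 / 25 * q3
  + om * eta * t ^+ 2 * (9 / 100 * f ^+ 2 + 9/20 * e ^+ 2 + 83 / 100 * e' ^+ 2).
  by rewrite /rhs /q1 /q2 /q3 Eh Eeta; field.
have ? : 0 <= q1.
  rewrite /q1; apply: addr_ge0; first exact: hypomonotone_slack.
  by apply: mulr_ge0; rewrite ?sqr_ge0//; exact: ltW.
have ? : 0 <= om * eta * t ^+ 2 by rewrite !mulr_ge0 ?sqr_ge0// ltW.
have ? : 0 <= om * t ^+ 2 by rewrite mulr_ge0 ?sqr_ge0// ltW.
have -> : om * eta * t ^+ 2 / 4 * q2 = om * eta * t ^+ 2 * (q2 / 4) by field.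
have -> : om * eta * t ^+ 2 / 25 * q3 = om * eta * t ^+ 2 * (q3 / 25) by field.
have := sqr_ge0 f; have := sqr_ge0 e; have := sqr_ge0 e' => e'2 e2 f2.
have := sqr_ge0 (g - 4 * y); have := sqr_ge0 (g + 2 * e).
rewrite -/q2 -/q3 => ? ?.
by do !apply: addr_ge0; apply: mulr_ge0 => //; lra.
Qed.

Lemma young (R : realFieldType) (c x y : R) :
  0 < c -> - (x * y) <= c / 2 * x ^+ 2 + y ^+ 2 / (2 * c).
Proof.
move=> c0; have cn : c != 0 by rewrite gt_eqF.
rewrite -subr_ge0.
have -> : c / 2 * x ^+ 2 + y ^+ 2 / (2 * c) - - (x * y)
  = (c * x + y) ^+ 2 / (2 * c) by field.
by rewrite divr_ge0 ?sqr_ge0// mulr_ge0 ?ltW.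
Qed.

(** The terms of order t. The parameters of the scheme leave no product D w, so
    each cross product has a factor among f, g, e', and Young's inequality
    charges half of the slow dissipation plus a term of order t in the fast
    variables, which is negligible against t^2. *)
Lemma cross_terms (R : realFieldType) (mu m n om b beta : R) :
  0 < mu -> 0 < n ->
  exists2 K : R, 0 <= K & forall t D w f g e e' a : R,
    0 <= t -> a = b * f + beta * g ->
    - t * (mu * D ^+ 2 + n * w ^+ 2)
    - t * (D * (m * e' + mu * a) + w * (n * e' + (m + om) * a) + m * a * e')
    <= - t * (mu / 2 * D ^+ 2 + n / 2 * w ^+ 2)
       + t * (K * (f ^+ 2 + g ^+ 2 + e ^+ 2 + e' ^+ 2)).
Proof.
move=> mu0 n0.
pose C1 := m ^+ 2 + (mu * b) ^+ 2 + (mu * beta) ^+ 2.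
pose C2 := n ^+ 2 + ((m + om) * b) ^+ 2 + ((m + om) * beta) ^+ 2.
pose C3 := m ^+ 2 + b ^+ 2 + beta ^+ 2.
exists (C1 / (2 * mu) + C2 / (2 * n) + C3 / 2).
  by rewrite /C1 /C2 /C3 !addr_ge0// divr_ge0 ?addr_ge0 ?sqr_ge0//; lra.
move=> t D w f g e e' a t0 Ea.
have E2 := sqr_ge0 e; pose N := e' ^+ 2 + f ^+ 2 + g ^+ 2.
have H1 : (m * e' + mu * a) ^+ 2 <= C1 * N.
  have -> : m * e' + mu * a = m * e' + (mu * b) * f + (mu * beta) * g.
    by rewrite Ea; ring.
  exact: sqr_lin3_le.
have H2 : (n * e' + (m + om) * a) ^+ 2 <= C2 * N.
  have -> : n * e' + (m + om) * a
    = n * e' + ((m + om) * b) * f + ((m + om) * beta) * g by rewrite Ea; ring.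
  exact: sqr_lin3_le.
have H3 : - (m * a * e') <= C3 / 2 * N.
  have Ha : a ^+ 2 <= (0 ^+ 2 + b ^+ 2 + beta ^+ 2) * N.
    have -> : a = 0 * e' + b * f + beta * g by rewrite Ea; ring.
    exact: sqr_lin3_le.
  have := @young _ 1 a (m * e') ltr01.
  have : m ^+ 2 * (f ^+ 2 + g ^+ 2) >= 0.
    by rewrite mulr_ge0 ?addr_ge0 ?sqr_ge0.
  by move: Ha; rewrite /C3 /N; lra.
have I1 := young D (m * e' + mu * a) mu0.
have I2 := young w (n * e' + (m + om) * a) n0.
have J1 : (m * e' + mu * a) ^+ 2 / (2 * mu) <= C1 / (2 * mu) * N.
  by rewrite [leRHS]mulrAC ler_wpM2r// invr_ge0; lra.
have J2 : (n * e' + (m + om) * a) ^+ 2 / (2 * n) <= C2 / (2 * n) * N.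
  by rewrite [leRHS]mulrAC ler_wpM2r// invr_ge0; lra.
set K := (X in X * (_ + e' ^+ 2)).
have KN : K * N <= K * (f ^+ 2 + g ^+ 2 + e ^+ 2 + e' ^+ 2).
  rewrite ler_wpM2l//; last by rewrite /N; lra.
  by rewrite /K /C1 /C2 /C3 !addr_ge0// divr_ge0 ?addr_ge0 ?sqr_ge0//; lra.
have inner : 0 <= K * (f ^+ 2 + g ^+ 2 + e ^+ 2 + e' ^+ 2)
    + mu / 2 * D ^+ 2 + n / 2 * w ^+ 2
    + D * (m * e' + mu * a) + w * (n * e' + (m + om) * a) + m * a * e'.
  have KE : K * N = C1 / (2 * mu) * N + C2 / (2 * n) * N + C3 / 2 * N.
    by rewrite -!mulrDl.
  clearbody K C1 C2 C3 N; lra.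
rewrite -subr_ge0; move: (mulr_ge0 t0 inner); congr (0 <= _); clearbody K; by field.
Qed.

Lemma bounded_terms (R : realFieldType) (r mu m om b : R) :
  0 <= r -> 0 <= mu -> 0 <= om -> 0 <= b ->
  exists2 K : R, 0 <= K & forall D w e' s v : R,
    s = mu * D + m * (w + e') -> v = (r + mu) * D + m * (w + e') ->
    r * (D * s) - r * mu / 2 * D ^+ 2 + s ^+ 2 / 2 + om * (w * v)
      + om * b / 2 * w ^+ 2
    <= K * (D ^+ 2 + w ^+ 2 + e' ^+ 2).
Proof.
move=> r0 mu0 om0 b0.
pose C1 := mu ^+ 2 + m ^+ 2 + m ^+ 2.
pose C2 := (r + mu) ^+ 2 + m ^+ 2 + m ^+ 2.
have C10 : 0 <= C1 by rewrite !addr_ge0 ?sqr_ge0.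
have C20 : 0 <= C2 by rewrite !addr_ge0 ?sqr_ge0.
exists (r / 2 * (1 + C1) + C1 / 2 + om / 2 * (1 + C2) + om * b / 2).
  have := mulr_ge0 om0 b0; have := mulr_ge0 r0 C10; have := mulr_ge0 om0 C20.
  by lra.
move=> D w e' s v Es Ev.
set N := D ^+ 2 + w ^+ 2 + e' ^+ 2.
have H1 : s ^+ 2 <= C1 * N.
  have -> : s = mu * D + m * w + m * e' by rewrite Es; ring.
  exact: sqr_lin3_le.
have H2 : v ^+ 2 <= C2 * N.
  have -> : v = (r + mu) * D + m * w + m * e' by rewrite Ev; ring.
  exact: sqr_lin3_le.
have D2 := sqr_ge0 D; have w2 := sqr_ge0 w; have e2 := sqr_ge0 e'.
have I1 : r * (D * s) <= r / 2 * (1 + C1) * N.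
  have -> : r / 2 * (1 + C1) * N = r * (N / 2 + C1 * N / 2) by field.
  by rewrite ler_wpM2l//; have := sqr_ge0 (D - s); rewrite /N in H1 *; lra.
have I2 : om * (w * v) <= om / 2 * (1 + C2) * N.
  have -> : om / 2 * (1 + C2) * N = om * (N / 2 + C2 * N / 2) by field.
  by rewrite ler_wpM2l//; have := sqr_ge0 (w - v); rewrite /N in H2 *; lra.
have I3 : om * b / 2 * w ^+ 2 <= om * b / 2 * N.
  by rewrite ler_wpM2l ?divr_ge0 ?mulr_ge0// /N; lra.
have I4 : 0 <= r * mu / 2 * D ^+ 2.
  by apply: mulr_ge0 => //; apply: divr_ge0 => //; apply: mulr_ge0.
clearbody C1 C2 N; lra.
Qed.

(** The product of x^{k+1} - x with the error e' has order 1, and no dissipation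
    controls the distance to the solution. The slowly decreasing weight K / t in
    the energy provides a term of order K X^2 / t^2, enough to split this product against the
    fast dissipation t^2 e'^2. *)
Lemma anchor_drift (R : realFieldType) (K k t X D e' : R) :
  0 < K -> 3 <= t ->
  K * (X ^+ 2 / (t + 1) - (X - D) ^+ 2 / t) - k * (X * e')
  <= 4 * K * D ^+ 2 + k ^+ 2 / K * (t ^+ 2 * e' ^+ 2).
Proof.
move=> K0 t3.
have t0 : 0 < t by lra.
have tn : t != 0 by rewrite gt_eqF.
have tn1 : t + 1 != 0 by rewrite gt_eqF//; lra.
have Kn : K != 0 by rewrite gt_eqF.
rewrite -subr_ge0.
set rhs := (X in 0 <= X).
have -> : rhs = K * (X / (2 * t) - 2 * D) ^+ 2
  + (K * X / (2 * t) + k * t * e') ^+ 2 / K + K * D ^+ 2 / t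
  + K * X ^+ 2 / t ^+ 2 * ((t - 1) / (2 * (t + 1))).
  by rewrite /rhs; field; rewrite tn tn1 Kn.
have K0' := ltW K0; have t0' := ltW t0.
do !apply: addr_ge0.
- by apply: mulr_ge0; rewrite ?sqr_ge0.
- by apply: divr_ge0; rewrite ?sqr_ge0.
- by apply: divr_ge0 => //; apply: mulr_ge0; rewrite ?sqr_ge0.
- apply: mulr_ge0; last by apply: divr_ge0; lra.
  by apply: divr_ge0; rewrite ?sqr_ge0//; apply: mulr_ge0; rewrite ?sqr_ge0.
Qed.

(** * The energy and its decrease *)

(** One coordinate of the Lyapunov function, with x measured from a solution and
    e = z^k - w^k. All the inequalities between vectors that are needed are
    quadratic with scalar coefficients, hence sums of the same inequalities
    between coordinates. The last two terms serve the discretisation errors;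
    their weights are the ones used in anchor_drift and fast_dissipation. *)
Definition energy (R : realFieldType) (r mu om b eta K t x V w e : R) : R :=
  (r * x + V) ^+ 2 / 2 + r * mu / 2 * x ^+ 2 - om * t * (w * V)
  + om * b / 2 * t ^+ 2 * w ^+ 2 + K / t * x ^+ 2
  + 2 * om * eta * t ^+ 2 * e ^+ 2.

(** The errors f = hat w^{k+1} - w^{k+1}, g = hat w^{k+1} - z^k, e = z^k - w^k
    and e' = z^{k+1} - w^{k+1} decay on the scale t^2, one order faster than the
    increment D = x^{k+1} - x^k and w = w^{k+1}. *)
Definition dissipation (R : realFieldType) (t D w f g e e' : R) : R :=
  t ^+ 2 * (f ^+ 2 + g ^+ 2 + e ^+ 2 + e' ^+ 2) + t * (D ^+ 2 + w ^+ 2).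

(** The relation between mu, om and b is what cancels the product D w at order
    t, as in continuous time. On the right, the products X w (anchor at the
    solution) and h D (consecutive iterates) get their signs, up to a defect, from
    co-hypomonotonicity. *)
Lemma energy_identity (R : realFieldType) (r mu om b beta K t : R)
    (X D w f g e e' eta m h a V v s : R) :
  (mu + 1) * om = mu * b -> t != 0 -> t + 1 != 0 ->
  eta = b + beta -> m = (r - 2) * om -> h = g + e - f -> a = b * f + beta * g ->
  V = t * (D + b * w + a) -> v = (r + mu) * D + m * (w + e') ->
  s = mu * D + m * (w + e') ->
  energy r mu om b eta K (t + 1) X (V - v) w e'
    - energy r mu om b eta K t (X - D) V (w - h) e
  = - (r * m) * (X * w) - r * m * (X * e')
    - om * t ^+ 2 * (h * D)
    - om * t ^+ 2 * (beta / 2 * h ^+ 2 - beta * (h * e)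
                     + eta / 2 * (g + e) ^+ 2 - eta / 2 * f ^+ 2)
    - t * (mu * D ^+ 2 + m * (b - om) * w ^+ 2)
    - t * (D * (m * e' + mu * a) + w * (m * (b - om) * e' + (m + om) * a)
           + m * a * e')
    + (r * (D * s) - r * mu / 2 * D ^+ 2 + s ^+ 2 / 2 + om * (w * v)
       + om * b / 2 * w ^+ 2)
    + K * (X ^+ 2 / (t + 1) - (X - D) ^+ 2 / t)
    + 2 * om * eta * ((t + 1) ^+ 2 * e' ^+ 2 - t ^+ 2 * e ^+ 2).
Proof.
move=> H t0 t1 -> -> -> -> -> -> ->; rewrite /energy.
(* The two sides differ by a multiple of the relation H. *)
apply/eqP; rewrite -subr_eq0; apply/eqP.
transitivity (t * D * w * ((mu + 1) * om - mu * b)); last by rewrite H subrr mulr0.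
by field; rewrite t0 t1.
Qed.

(** A perturbation one order in t below the dissipation is eventually absorbed
    by half of it. *)
Lemma absorb (R : realFieldType) (A B k : R) :
  0 < A -> 0 < B -> 0 <= k ->
  exists2 c : R, 0 < c & exists2 t1 : R, 3 <= t1 & forall t N S : R,
    t1 <= t -> 0 <= N -> 0 <= S ->
    k * (t * N + S) + c * (t ^+ 2 * N + t * S)
    <= A * (t ^+ 2 * N) + B * (t * S).
Proof.
move=> A0 B0 k0; pose c := Num.min (A / 2) (B / 2).
have cA : c <= A / 2 by rewrite ge_min lexx.
have cB : c <= B / 2 by rewrite ge_min lexx orbT.
have kA : 0 <= 2 * k / A by apply: divr_ge0; lra.
have kB : 0 <= 2 * k / B by apply: divr_ge0; lra.
exists c; first by rewrite lt_min !divr_gt0.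
exists (3 + 2 * k / A + 2 * k / B) => [|t N S tt N0 S0]; first by lra.
have tA : 2 * k <= t * A by rewrite -ler_pdivrMr//; lra.
have tB : 2 * k <= t * B by rewrite -ler_pdivrMr//; lra.
have t0 : 0 <= t by lra.
have tN : 0 <= t * N by exact: mulr_ge0.
have tS : 0 <= t * S by exact: mulr_ge0.
have I1 : k * (t * N) <= t * A / 2 * (t * N) by rewrite ler_wpM2r//; lra.
have I2 : k * S <= t * B / 2 * S by rewrite ler_wpM2r//; lra.
have I3 : c * (t ^+ 2 * N) <= A / 2 * (t ^+ 2 * N).
  by rewrite ler_wpM2r// mulr_ge0 ?sqr_ge0.
have I4 : c * (t * S) <= B / 2 * (t * S) by rewrite ler_wpM2r.
clearbody c; clear tA tB tt kA kB; lra.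
Qed.

Lemma fast_slow_bounds (R : realFieldType) (w f g e e' z : R) :
  z = w + f - g ->
  let N := f ^+ 2 + g ^+ 2 + e ^+ 2 + e' ^+ 2 in
  [/\ 0 <= N, e' ^+ 2 <= N & z ^+ 2 <= 3 * (w ^+ 2 + N)].
Proof.
move=> Ez N.
have f2 := sqr_ge0 f; have g2 := sqr_ge0 g; have e2 := sqr_ge0 e.
have e'2 := sqr_ge0 e'; rewrite /N; split; [lra|lra|].
have -> : z = 1 * w + 1 * f + (-1) * g by rewrite Ez; ring.
by have := sqr_lin3_le 1 1 (-1) w f g; lra.
Qed.

Lemma lower_order (R : realFieldType) (P C K1 K2 K q t N D2 w2 e2 z2 : R) :
  0 <= P -> 0 <= C -> 0 <= K1 -> 0 <= K2 -> 0 <= K -> 0 <= q -> 3 <= t ->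
  0 <= D2 -> 0 <= w2 -> 0 <= e2 -> e2 <= N -> z2 <= 3 * (w2 + N) ->
  2 * P * (2 * t + 1) * e2 + C * z2 + t * (K1 * N) + K2 * (D2 + w2 + e2)
    + 4 * K * D2 + q * w2
  <= (6 * P + 3 * C + K1 + K2 + 4 * K + q) * (t * N + (D2 + w2)).
Proof.
move=> P0 C0 K10 K20 K0 q0 t3 D0 w0 e0 eN zN.
have N0 : 0 <= N by exact: le_trans eN.
have tN : N <= t * N by rewrite ler_peMl//; lra.
have te : 0 <= (t - 1) * e2 by apply: mulr_ge0 => //; lra.
have teN : 0 <= t * (N - e2) by apply: mulr_ge0; lra.
set L := t * N + (D2 + w2).
have H1 : 2 * P * (2 * t + 1) * e2 <= 6 * P * L.
  rewrite -mulrA -[leRHS]mulrA; clear - P0 te teN D0 w0 e0.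
  have : 0 <= P * (3 * L - (2 * t + 1) * e2).
    by apply: mulr_ge0 => //; rewrite /L; lra.
  by clearbody L; lra.
have H2 : C * z2 <= C * (3 * L) by rewrite ler_wpM2l// /L; lra.
have H3 : K1 * (t * N) <= K1 * L by rewrite ler_wpM2l// /L; lra.
have H4 : K2 * (D2 + w2 + e2) <= K2 * L by rewrite ler_wpM2l// /L; lra.
have H5 : K * D2 <= K * L.
  by rewrite ler_wpM2l// /L; clear - tN N0 w0; lra.
have H6 : q * w2 <= q * L.
  by rewrite ler_wpM2l// /L; clear - tN N0 D0; lra.
clearbody L; clear - H1 H2 H3 H4 H5 H6; lra.
Qed.

(** One step of the scheme, coordinate by coordinate. The three products added to
    the new energy become nonnegative when summed over the coordinates: they are
    the two co-hypomonotonicity inequalities and the error estimate on the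
    directions. *)
Lemma energy_decrease (R : realFieldType) (r mu om b beta rho : R) :
  2 < r -> 0 < mu -> 0 < om -> om < b -> (mu + 1) * om = mu * b ->
  0 <= rho -> 8 * rho <= beta ->
  exists K c t1 : R, [/\ 0 <= K, 0 < c &
    forall t X D w f g e e' eta m h z V v : R, t1 <= t ->
    eta = b + beta -> m = (r - 2) * om -> h = g + e - f -> z = w + f - g ->
    V = t * (D + b * w + (b * f + beta * g)) ->
    v = (r + mu) * D + m * (w + e') ->
    energy r mu om b eta K (t + 1) X (V - v) w e'
      + r * m * (X * w + rho * w ^+ 2)
      + om * t ^+ 2 * (h * D + rho * h ^+ 2)
      + 4 / 25 * om * eta * t ^+ 2
        * ((g + (r - 1) / t * z) ^+ 2 - 4 * f ^+ 2 - 18 * e' ^+ 2)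
      + c * dissipation t D w f g e e'
    <= energy r mu om b eta K t (X - D) V (w - h) e].
Proof.
move=> r2 mu0 om0 omb rel rho0 hrho.
have b0 : 0 < b by lra.
have beta0 : 0 <= beta by lra.
pose eta := b + beta; pose m := (r - 2) * om; pose n := m * (b - om).
have eta0 : 0 < eta by rewrite /eta; lra.
have m0 : 0 < m by rewrite mulr_gt0//; lra.
have n0 : 0 < n by rewrite mulr_gt0//; lra.
have [K1 K10 HK1] := cross_terms m om b beta mu0 n0.
have r0 : 0 <= r by lra.
have [K2 K20 HK2] := bounded_terms m r0 (ltW mu0) (ltW om0) (ltW b0).
have ometa : 0 < om * eta by rewrite mulr_gt0.
(* Half of the fast dissipation om * eta / 20 of fast_dissipation; one unit A
   pays for the anchor term, one for the lower-order terms. *)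
pose A := om * eta / 40.
have A0 : 0 < A by rewrite divr_gt0.
have rm0 : 0 < r * m by rewrite mulr_gt0//; lra.
pose K := (r * m) ^+ 2 / A.
have K0 : 0 < K by apply: divr_gt0 => //; apply: exprn_gt0.
have KA : (r * m) ^+ 2 / K = A.
  by rewrite /K; field; rewrite !gt_eqF//; lra.
pose C := 4 / 5 * om * eta * (r - 1) ^+ 2.
have C0 : 0 <= C by apply: mulr_ge0; rewrite ?sqr_ge0//; lra.
pose k := 6 * om * eta + 3 * C + K1 + K2 + 4 * K + r * m * rho.
have rmrho : 0 <= r * m * rho by apply: mulr_ge0 => //; exact: ltW.
have k0 : 0 <= k by rewrite /k; lra.
pose B := Num.min (mu / 2) (n / 2).
have B0 : 0 < B by rewrite lt_min !divr_gt0.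
have [c c0 [t1 t13 Habs]] := absorb A0 B0 k0.
exists K, c, t1; split => //; first exact: ltW.
move=> t X D w f g e e' _ _ h z V v t1t -> -> Eh Ez EV Ev.
rewrite -/eta -/m.
have t3 : 3 <= t := le_trans t13 t1t.
have t0 : 0 < t by lra.
have tn : t != 0 by rewrite gt_eqF.
have tn1 : t + 1 != 0 by rewrite gt_eqF//; lra.
pose a := b * f + beta * g; pose s := mu * D + m * (w + e').
have Id := @energy_identity _ r mu om b beta K t X D w f g e e' eta m h a V v s
  rel tn tn1 erefl erefl Eh erefl EV Ev erefl.
have F := @fast_dissipation _ om b beta rho (r - 1) t w f g e e' eta h z
  erefl Eh Ez om0 b0 beta0 hrho t0.
have Cr := HK1 t D w f g e e' a (ltW t0) erefl.
have Br := HK2 D w e' s v erefl Ev.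
have An := anchor_drift (r * m) X D e' K0 t3.
rewrite KA in An.
have [N0 e'N Z] := fast_slow_bounds e e' Ez.
pose N := f ^+ 2 + g ^+ 2 + e ^+ 2 + e' ^+ 2.
pose S := D ^+ 2 + w ^+ 2.
have S0 : 0 <= S by rewrite addr_ge0 ?sqr_ge0.
have Ab := Habs t N S t1t N0 S0.
have low := @lower_order _ (om * eta) C K1 K2 K (r * m * rho) t N (D ^+ 2)
  (w ^+ 2) (e' ^+ 2) (z ^+ 2) (ltW ometa) C0 K10 K20 (ltW K0) rmrho t3
  (sqr_ge0 D) (sqr_ge0 w) (sqr_ge0 e') e'N Z.
have B1 : A * (t ^+ 2 * e' ^+ 2) <= A * (t ^+ 2 * N).
  by apply: ler_wpM2l; [exact: ltW | apply: ler_wpM2l; rewrite ?sqr_ge0].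
have Bmu : B <= mu / 2 by rewrite ge_min lexx.
have Bn : B <= n / 2 by rewrite ge_min lexx orbT.
have G2 : B * (t * D ^+ 2) <= mu / 2 * (t * D ^+ 2).
  by rewrite ler_wpM2r// mulr_ge0 ?sqr_ge0 ?ltW.
have G3 : B * (t * w ^+ 2) <= n / 2 * (t * w ^+ 2).
  by rewrite ler_wpM2r// mulr_ge0 ?sqr_ge0 ?ltW.
rewrite /dissipation -/N -/S.
have Ek : k = 6 * (om * eta) + 3 * C + K1 + K2 + 4 * K + r * m * rho.
  by rewrite /k; ring.
rewrite -Ek in low.
have EA : om * eta / 20 = 2 * A by rewrite /A; field.
rewrite EA -/C -/N in F; rewrite -/N in Cr; rewrite -/n in Id.
set E1 := energy _ _ _ _ _ _ (t + 1) _ _ _ _ in Id *.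
set E0 := energy _ _ _ _ _ _ t _ _ _ _ in Id *.
clear EA Ek.
have ES : S = D ^+ 2 + w ^+ 2 by [].
clearbody E1 E0 N A C K n eta a s m B k S.
clear - Id F Cr Br An Ab low B1 G2 G3 ES.
rewrite ES in Ab low *.
lra.
Qed.

(** The part of the energy that is not controlled by the squares of x and V.
    Along the flow V = t (x' + b w) its derivative is t^2 x' w' plus terms of
    order t in the squares of x' and w, so it is almost monotone. *)
Definition coupling (R : realFieldType) (b t V w : R) : R :=
  t * (w * V) - b / 2 * t ^+ 2 * w ^+ 2.

(** Completing the square in r x + V - om t w leaves om (b - om) t^2 w^2 / 2,
    which for large t dominates the co-hypomonotonicity defect om r t rho w^2. *)
Lemma energy_ge (R : realFieldType) (r mu om b eta rho K : R) :
  0 <= r -> 0 <= mu -> 0 < om -> om < b -> 0 <= eta -> 0 <= rho -> 0 <= K ->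
  exists2 t1 : R, 0 < t1 & forall t x V w e : R, t1 <= t ->
    om * r * t * (x * w + rho * w ^+ 2) <= energy r mu om b eta K t x V w e.
Proof.
move=> r0 mu0 om0 omb eta0 rho0 K0.
have q0 : 0 <= 2 * r * rho / (b - om).
  by apply: divr_ge0; [apply: mulr_ge0 => //; lra|lra].
exists (1 + 2 * r * rho / (b - om)) => [|t x V w e tt]; first by lra.
have t0 : 0 < t by lra.
have tb : 2 * r * rho <= t * (b - om) by rewrite -ler_pdivrMr//; lra.
rewrite -subr_ge0; set rhs := (X in 0 <= X).
have -> : rhs = (r * x + V - om * t * w) ^+ 2 / 2 + r * mu / 2 * x ^+ 2
  + om * t / 2 * (t * (b - om) - 2 * r * rho) * w ^+ 2 + K / t * x ^+ 2
  + 2 * om * eta * t ^+ 2 * e ^+ 2.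
  by rewrite /rhs /energy; field; rewrite gt_eqF.
have omt : 0 <= om * t by apply: mulr_ge0; exact: ltW.
have := mulr_ge0 r0 mu0; have := mulr_ge0 (ltW om0) eta0 => ome rmu.
do !apply: addr_ge0.
- by apply: divr_ge0; rewrite ?sqr_ge0.
- by apply: mulr_ge0; rewrite ?sqr_ge0//; lra.
- by apply: mulr_ge0; rewrite ?sqr_ge0//; apply: mulr_ge0; lra.
- by apply: mulr_ge0; rewrite ?sqr_ge0//; apply: divr_ge0; lra.
- apply: mulr_ge0; rewrite ?sqr_ge0//.
  by apply: mulr_ge0; rewrite ?sqr_ge0//; lra.
Qed.

Lemma dissipation_ge (R : realFieldType) (t D w f g e e' : R) : 1 <= t ->
  t * (D ^+ 2 + w ^+ 2 + (f ^+ 2 + g ^+ 2 + e ^+ 2 + e' ^+ 2))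
  <= dissipation t D w f g e e'.
Proof.
move=> t1; rewrite /dissipation; set N := f ^+ 2 + _ + _ + _.
have N0 : 0 <= N by rewrite !addr_ge0 ?sqr_ge0.
have : 0 <= t * (t - 1) * N by apply: mulr_ge0 => //; apply: mulr_ge0; lra.
by clearbody N; lra.
Qed.

Lemma speed_sqr_le (R : realFieldType) (b beta : R) :
  exists2 C : R, 0 <= C & forall D w f g e e' : R,
    (D + b * w + (b * f + beta * g)) ^+ 2
    <= C * (D ^+ 2 + w ^+ 2 + (f ^+ 2 + g ^+ 2 + e ^+ 2 + e' ^+ 2)).
Proof.
have b2 := sqr_ge0 b; have beta2 := sqr_ge0 beta.
pose C1 := 2 + b ^+ 2; pose C2 := b ^+ 2 + beta ^+ 2.
have C10 : 0 <= C1 by rewrite /C1; lra.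
have C20 : 0 <= C2 by rewrite /C2; lra.
have C120 := mulr_ge0 C10 C20.
exists (C1 * (1 + C2)) => [|D w f g e e']; first by apply: mulr_ge0; lra.
set a := b * f + beta * g.
have H1 : (D + b * w + a) ^+ 2 <= C1 * (D ^+ 2 + w ^+ 2 + a ^+ 2).
  have -> : D + b * w + a = 1 * D + b * w + 1 * a by ring.
  by apply: le_trans (sqr_lin3_le _ _ _ _ _ _) _; rewrite /C1; lra.
have H2 : a ^+ 2 <= C2 * (f ^+ 2 + g ^+ 2).
  have -> : a = b * f + beta * g + 0 * 0 by rewrite /a; ring.
  by apply: le_trans (sqr_lin3_le _ _ _ _ _ _) _; rewrite /C2; lra.
apply: le_trans H1 _; rewrite -mulrA ler_wpM2l//.
have fg : 0 <= f ^+ 2 + g ^+ 2 by rewrite addr_ge0 ?sqr_ge0.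
have : 0 <= C2 * (D ^+ 2 + w ^+ 2 + e ^+ 2 + e' ^+ 2).
  by rewrite mulr_ge0// !addr_ge0 ?sqr_ge0.
have := sqr_ge0 e; have := sqr_ge0 e'.
by clearbody C2 a; lra.
Qed.

(** The square of V decreases by at most a summable amount, and divided by t it
    is summable: the two hypotheses of quasi_nondecreasing_cvg0. *)
Lemma velocity_variation (R : realFieldType) (b beta p m : R) :
  exists2 C : R, 0 <= C & forall t D w f g e e' V v : R, 1 <= t ->
    V = t * (D + b * w + (b * f + beta * g)) -> v = p * D + m * (w + e') ->
    V ^+ 2 <= (V - v) ^+ 2 + C * dissipation t D w f g e e'
    /\ V ^+ 2 <= t * (C * dissipation t D w f g e e').
Proof.
have [C1 C10 H1] := speed_sqr_le b beta.
pose C2 := p ^+ 2 + m ^+ 2 + m ^+ 2.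
have C20 : 0 <= C2 by rewrite !addr_ge0 ?sqr_ge0.
exists (C1 + C2) => [|t D w f g e e' V v t1 EV Ev]; first by rewrite addr_ge0.
have Ml := dissipation_ge D w f g e e' t1.
have lM := H1 D w f g e e'.
set Y := dissipation _ _ _ _ _ _ _ in Ml *.
set N := f ^+ 2 + _ + _ + _ in Ml lM *.
set M := D ^+ 2 + w ^+ 2 + N in Ml lM *.
have f2 := sqr_ge0 f; have g2 := sqr_ge0 g; have e2 := sqr_ge0 e.
have M0 : 0 <= M by rewrite /M /N !addr_ge0 ?sqr_ge0.
have vM : v ^+ 2 <= C2 * M.
  have -> : v = p * D + m * w + m * e' by rewrite Ev; ring.
  apply: le_trans (sqr_lin3_le _ _ _ _ _ _) _.
  by rewrite ler_wpM2l// /M /N; lra.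
set l := D + b * w + _ in EV lM.
have t0 : 0 <= t by lra.
have J1 : t * (C1 * M) <= C1 * Y by rewrite mulrCA ler_wpM2l.
have J2 : t * (C2 * M) <= C2 * Y by rewrite mulrCA ler_wpM2l.
have tl : t * l ^+ 2 <= C1 * Y by apply: le_trans J1; rewrite ler_wpM2l.
have tv : t * v ^+ 2 <= C2 * Y by apply: le_trans J2; rewrite ler_wpM2l.
have Y0 : 0 <= C2 * Y by apply: le_trans tv; rewrite mulr_ge0 ?sqr_ge0.
split.
  have : 0 <= t * (l - v) ^+ 2 by rewrite mulr_ge0 ?sqr_ge0.
  have := sqr_ge0 v; rewrite EV; clearbody l Y C2; lra.
have : 0 <= t * (C1 * Y + C2 * Y - t * l ^+ 2) by rewrite mulr_ge0//; lra.
rewrite EV; clearbody l Y C2; lra.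
Qed.

(** The same two properties for the coupling term; its increase t^2 h D is
    bounded below by co-hypomonotonicity after summation over coordinates. *)
Lemma coupling_variation (R : realFieldType) (b beta rho p m : R) :
  0 < b -> 0 <= beta -> 8 * rho <= beta ->
  exists2 C : R, 0 <= C & forall t D w f g e e' h V v : R, 1 <= t ->
    h = g + e - f ->
    V = t * (D + b * w + (b * f + beta * g)) -> v = p * D + m * (w + e') ->
    coupling b t V (w - h) + t ^+ 2 * (h * D + rho * h ^+ 2)
      <= coupling b (t + 1) (V - v) w + C * dissipation t D w f g e e'
    /\ `|coupling b t V (w - h)| <= t * (C * dissipation t D w f g e e').
Proof.
move=> b0 beta0 hrho.
have [C1 C10 H1] := speed_sqr_le b beta.
pose C2 := p ^+ 2 + m ^+ 2 + m ^+ 2.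
have C20 : 0 <= C2 by rewrite !addr_ge0 ?sqr_ge0.
pose C := C1 + C2 + 6 * (1 + b) + (b + beta).
exists C => [|t D w f g e e' h V v t1 Eh EV Ev]; first by rewrite /C; lra.
have Ml := dissipation_ge D w f g e e' t1.
have lM := H1 D w f g e e'.
set N := f ^+ 2 + _ + _ + _ in Ml lM *.
have EY : dissipation t D w f g e e' = t ^+ 2 * N + t * (D ^+ 2 + w ^+ 2) by [].
set Y := dissipation _ _ _ _ _ _ _ in Ml EY *.
set M := D ^+ 2 + w ^+ 2 + N in Ml lM *.
have D2 := sqr_ge0 D; have w2 := sqr_ge0 w.
have f2 := sqr_ge0 f; have g2 := sqr_ge0 g; have e2 := sqr_ge0 e.
have e'2 := sqr_ge0 e'.
have N0 : 0 <= N by rewrite /N; lra.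
have M0 : 0 <= M by rewrite /M; lra.
have wM : w ^+ 2 <= M by rewrite /M; lra.
have vM : v ^+ 2 <= C2 * M.
  have -> : v = p * D + m * w + m * e' by rewrite Ev; ring.
  apply: le_trans (sqr_lin3_le _ _ _ _ _ _) _.
  by rewrite ler_wpM2l// /M /N; lra.
have hM : (w - h) ^+ 2 <= 6 * M.
  have : h ^+ 2 <= 3 * N.
    have -> : h = 1 * g + 1 * e + (-1) * f by rewrite Eh; ring.
    by apply: le_trans (sqr_lin3_le _ _ _ _ _ _) _; rewrite /N; lra.
  by have := sqr_ge0 (w + h); rewrite /M; lra.
set l := D + b * w + _ in EV lM.
have t0 : 0 <= t by lra.
have tM : 0 <= t * M by exact: mulr_ge0.
have Y0 : 0 <= Y by lra.
have tl : t * l ^+ 2 <= C1 * Y.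
  apply: le_trans (_ : t * (C1 * M) <= _); first by rewrite ler_wpM2l.
  by rewrite mulrCA ler_wpM2l.
have tv : t * v ^+ 2 <= C2 * Y.
  apply: le_trans (_ : t * (C2 * M) <= _); first by rewrite ler_wpM2l.
  by rewrite mulrCA ler_wpM2l.
have tw : t * w ^+ 2 <= Y.
  by apply: le_trans Ml; rewrite ler_wpM2l.
have th : t * (w - h) ^+ 2 <= 6 * Y.
  apply: le_trans (_ : t * (6 * M) <= _); first by rewrite ler_wpM2l.
  by lra.
have bw : t * (b * w ^+ 2) <= b * Y by rewrite mulrCA ler_wpM2l// ltW.
have bh : t * (b * (w - h) ^+ 2) <= b * (6 * Y) by rewrite mulrCA ler_wpM2l// ltW.
have C1Y : 0 <= C1 * Y by exact: mulr_ge0.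
have C2Y : 0 <= C2 * Y by exact: mulr_ge0.
have bY : 0 <= b * Y by rewrite mulr_ge0 ?(ltW b0).
have betaY : 0 <= beta * Y by exact: mulr_ge0.
have EC : C * Y = C1 * Y + C2 * Y + 6 * Y + 6 * (b * Y) + (b * Y + beta * Y).
  by rewrite /C; ring.
split.
  rewrite -subr_ge0 EC; set rhs := (X in 0 <= X).
  pose eta := b + beta.
  pose q1 := beta / 2 * h ^+ 2 - beta * (h * e) - rho * h ^+ 2 + beta * e ^+ 2.
  have q10 : 0 <= q1 by exact: hypomonotone_slack.
  have -> : rhs = t ^+ 2 * (q1 + eta / 2 * (g + e) ^+ 2)
      - t ^+ 2 * (beta * e ^+ 2 + eta / 2 * f ^+ 2)
      - (t + 1) * (w * v) + t * (w * l) - b / 2 * (2 * t + 1) * w ^+ 2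
      + (C1 * Y + C2 * Y + 6 * Y + 6 * (b * Y) + (b * Y + beta * Y)).
    by rewrite /rhs /coupling /q1 /eta EV /l Eh; clearbody Y; field.
  have eta0 : 0 <= eta by rewrite addr_ge0// ltW.
  have J1 : 0 <= t ^+ 2 * (q1 + eta / 2 * (g + e) ^+ 2).
    rewrite mulr_ge0 ?sqr_ge0// addr_ge0//.
    by apply: mulr_ge0; rewrite ?sqr_ge0// divr_ge0.
  have J2 : t ^+ 2 * (beta * e ^+ 2 + eta / 2 * f ^+ 2) <= b * Y + beta * Y.
    have tN : t ^+ 2 * N <= Y.
      by rewrite EY lerDl mulr_ge0// addr_ge0.
    have le1 : beta * e ^+ 2 + eta / 2 * f ^+ 2 <= eta * N.
      have bN : beta * e ^+ 2 <= eta * e ^+ 2.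
        by rewrite ler_wpM2r// lerDr ltW.
      have : 0 <= eta * (N - e ^+ 2 - f ^+ 2 / 2).
        by rewrite mulr_ge0// /N; clear - f2 g2 e'2; lra.
      by clearbody eta N; clear - bN; lra.
    have : t ^+ 2 * (beta * e ^+ 2 + eta / 2 * f ^+ 2) <= t ^+ 2 * (eta * N).
      by rewrite ler_wpM2l ?sqr_ge0.
    have : eta * (t ^+ 2 * N) <= eta * Y by rewrite ler_wpM2l.
    by rewrite /eta; clearbody Y N; clear; lra.
  have t10 : 0 <= t + 1 by rewrite addr_ge0.
  have J3 : (t + 1) * (w * v) <= t * w ^+ 2 + t * v ^+ 2.
    have : 0 <= (t + 1) * (w - v) ^+ 2 by rewrite mulr_ge0 ?sqr_ge0.
    have : 0 <= (t - 1) * (w ^+ 2 + v ^+ 2).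
      by rewrite mulr_ge0 ?subr_ge0// addr_ge0 ?sqr_ge0.
    by clear; lra.
  have J4 : 0 <= t * (w + l) ^+ 2 by rewrite mulr_ge0 ?sqr_ge0.
  have J5 : 0 <= b * (t - 1) * w ^+ 2.
    by rewrite mulr_ge0// mulr_ge0 ?subr_ge0// ltW.
  clear - J1 J2 J3 J4 J5 tl tv tw bw C1Y C2Y bY betaY Y0.
  set u1 := t ^+ 2 * _ in J1 *; set u2 := t ^+ 2 * _ in J2 *.
  clearbody u1 u2 l Y C2; lra.
have -> : coupling b t V (w - h)
  = t * (t * ((w - h) * l) - t * (b / 2 * (w - h) ^+ 2)).
  by rewrite /coupling EV; field.
rewrite normrM (ger0_norm t0) ler_wpM2l// EC ler_norml.
have J1 : 0 <= t * ((w - h) - l) ^+ 2 by rewrite mulr_ge0 ?sqr_ge0.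
have J2 : 0 <= t * ((w - h) + l) ^+ 2 by rewrite mulr_ge0 ?sqr_ge0.
have J3 : 0 <= t * (b * (w - h) ^+ 2).
  by apply: mulr_ge0 => //; apply: mulr_ge0; rewrite ?sqr_ge0// ltW.
clear - J1 J2 J3 tl th bh C1Y C2Y bY betaY Y0.
set k := w - h in J1 J2 J3 th bh *.
by clearbody k l Y C2; apply/andP; split; lra.
Qed.

(** * Summability and convergence of real sequences *)

Lemma is_cvg_series_tail (R : realType) (N : nat) (a : R^nat) :
  cvgn (series (fun n => if (N <= n)%N then a n else 0)) = cvgn (series a).
Proof.
rewrite -(is_cvg_series_restrict N) -[RHS](is_cvg_series_restrict N).
set b := [sequence _]_n; set c := [sequence _]_n.
suff -> : b = c by [].
by apply/funext => n; apply: eq_big_nat => k /andP[-> _].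
Qed.

Lemma series_le_cvg_near (R : realType) (u v : R^nat) :
  (\forall k \near \oo, 0 <= u k <= v k) -> cvgn (series v) ->
  cvgn (series u).
Proof.
move=> [N _ uv]; rewrite -(is_cvg_series_tail N v) -(is_cvg_series_tail N u).
apply: series_le_cvg => n; case: ifPn => // /uv /andP[]//.
exact: le_trans.
Qed.

Lemma cvg_series_of_decrease (R : realType) (E D : R^nat) :
  (\forall k \near \oo, 0 <= E k) -> (\forall k \near \oo, 0 <= D k) ->
  (\forall k \near \oo, E k.+1 + D k <= E k) -> cvgn (series D).
Proof.
move=> E0 D0 ED.
have [N _ HN] : \forall k \near \oo, [/\ 0 <= E k, 0 <= D k & E k.+1 + D k <= E k].
  by near=> k; split; near: k.
rewrite -(is_cvg_series_restrict N); apply: nondecreasing_is_cvgn.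
  apply/nondecreasing_seqP => n /=; case: (leqP N n) => Nn.
    by rewrite big_nat_recr//= lerDl; case: (HN n Nn).
  by rewrite !big_geq// ltnW.
exists (E N) => _ [n _ <-] /=.
have [Nn|nN] := leqP N n; last by rewrite big_geq 1?ltnW//; case: (HN N (leqnn _)).
suff : \sum_(N <= k < n) D k + E n <= E N.
  by have [] := HN n Nn; lra.
elim: n Nn => [|n IH]; first by rewrite leqn0 => /eqP->; rewrite big_geq// add0r.
rewrite leq_eqVlt => /orP[/eqP <-|Nn]; first by rewrite big_geq// add0r.
by rewrite big_nat_recr//=; have := IH Nn; have [] := HN n Nn; lra.
Unshelve. all: by end_near. Qed.

(** Summability of |s_k| / (k + t0) and divergence of the harmonic series force s
    to return arbitrarily late to any neighbourhood of 0; between two returns it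
    can neither rise nor fall by more than a tail of the series of a. *)
Lemma quasi_nondecreasing_cvg0 (R : realType) (t0 : R) (s a : R^nat) :
  0 < t0 -> cvgn (series a) ->
  (\forall k \near \oo, s k <= s k.+1 + a k) ->
  (\forall k \near \oo, `|s k| <= (k%:R + t0) * a k) ->
  s @ \oo --> 0.
Proof.
move=> t00 ca sa sta.
have often c N : 0 < c -> exists2 j, (N <= j)%N & `|s j| < c.
  move=> c0; apply: contrapT => H.
  have {}H j : (N <= j)%N -> c <= `|s j|.
    by move=> Nj; rewrite leNgt; apply/negP => ?; apply: H; exists j.
  apply: (@dvg_harmonic R).
  apply: (@series_le_cvg_near _ _ (((t0 + 1) / c) *: a)); last first.
    exact: is_cvg_seriesZ.
  near=> j; rewrite harmonic_ge0/= /harmonic/=.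
  have Nj : (N <= j)%N by near: j; exact: nbhs_infty_ge.
  have sj : `|s j| <= (j%:R + t0) * a j by near: j.
  have tj : j%:R + t0 <= (t0 + 1) * j.+1%:R.
    have := ler0n R j; have := mulr_ge0 (ltW t00) (ler0n R j).
    by rewrite -natr1; lra.
  have aj : 0 <= a j.
    have : 0 <= (j%:R + t0) * a j by exact: le_trans sj.
    by rewrite pmulr_rge0// ltr_wpDl.
  have -> : (((t0 + 1) / c) *: a) j = (t0 + 1) / c * a j by [].
  rewrite -[leLHS]mul1r ler_pdivrMr ?ltr0n//.
  have -> : (t0 + 1) / c * a j * j.+1%:R = (t0 + 1) * j.+1%:R * a j / c.
    by field; rewrite gt_eqF.
  rewrite ler_pdivlMr// mul1r.
  apply: le_trans (H j Nj) _; apply: le_trans sj _; exact: ler_wpM2r.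
move: (ca) => /cvg_ex[l al].
apply/cvgr0Pnorm_lt => e e0.
have e4 : 0 < e / 4 by rewrite divr_gt0.
have [N _ HN] : \forall k \near \oo,
    `|l - series a k| < e / 4 /\ s k <= s k.+1 + a k.
  near=> k; split; near: k => //.
  by move/cvgrPdist_lt : al; exact.
have mono j k : (N <= j)%N -> (j <= k)%N -> s j <= s k + e / 2.
  move=> Nj jk.
  have : s j <= s k + (series a k - series a j).
    elim: k jk => [|k IH].
      by rewrite leqn0 => /eqP->; rewrite subrr addr0.
    rewrite leq_eqVlt => /orP[/eqP <-|jk]; first by rewrite subrr addr0.
    have [_] := HN k (leq_trans Nj jk).
    by have := IH jk; rewrite seriesSr; lra.
  have [] := HN j Nj; have [] := HN k (leq_trans Nj jk).
  by rewrite !ltr_norml => /andP[? ?] _ /andP[? ?] _; lra.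
have e2 : 0 < e / 2 by rewrite divr_gt0.
have [j0 Nj0] := often (e / 2) N e2; rewrite ltr_norml => /andP[j0l _].
near=> k.
have j0k : (j0 <= k)%N by near: k; exact: nbhs_infty_ge.
have [j kj] := often (e / 2) k e2; rewrite ltr_norml => /andP[_ ju].
have := mono j0 k Nj0 j0k; have := mono k j (leq_trans Nj0 j0k) kj.
by rewrite ltr_norml => ? ?; apply/andP; split; lra.
Unshelve. all: by end_near. Qed.

(** * The abstract flow *)

Lemma near_infty_shift_ge (R : realType) (t0 A : R) :
  \forall k \near \oo, A <= k%:R + t0.
Proof.
near=> k; rewrite -lerBlDr; near: k; exact: nbhs_infty_ger.
Unshelve. all: by end_near. Qed.

Lemma cvg0_scale (R : realType) (c : R) (u : R^nat) :
  u @ \oo --> (0 : R) -> (fun k => c * u k) @ \oo --> (0 : R).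
Proof.
by move=> u0; rewrite -(mulr0 c); apply: cvgM => //; exact: cvg_cst.
Qed.

(** The scheme in abstract form: a sequence V with the increments displayed
    below, co-hypomonotonicity along the iterates and relative to xs, and the
    error estimate on the directions. The energy is eventually nonincreasing,
    so the dissipation Y is summable; this gives the fast variables at once,
    while V and w follow from quasi_nondecreasing_cvg0. *)
Lemma flow_asymptotics (R : realType) (p : nat) (r mu om b beta rho t0 : R)
    (xs : 'rV[R]_p) (x V w f g e : nat -> 'rV[R]_p) :
  let t := fun k : nat => k%:R + t0 in
  2 < r -> 0 < mu -> 0 < om -> om < b -> (mu + 1) * om = mu * b ->
  0 <= rho -> 8 * rho <= beta -> 0 < t0 ->
  (forall k, w k = w k.+1 - (g k + e k - f k)) ->
  (forall k, V k = t k *: (x k.+1 - x k + b *: w k.+1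
                           + (b *: f k + beta *: g k))) ->
  (forall k, V k.+1 = V k - ((r + mu) *: (x k.+1 - x k)
                             + ((r - 2) * om) *: (w k.+1 + e k.+1))) ->
  (forall k, 0 <= dotr (w k.+1 - w k) (x k.+1 - x k)
                  + rho * dotr (w k.+1 - w k) (w k.+1 - w k)) ->
  (forall k, 0 <= dotr (x k - xs) (w k) + rho * dotr (w k) (w k)) ->
  (forall k, 4 * dotr (f k) (f k) + 18 * dotr (e k.+1) (e k.+1)
     <= let d := g k + ((r - 1) / t k) *: (w k.+1 + f k - g k) in dotr d d) ->
  [/\ (fun k => dotr (V k) (V k)) @ \oo --> (0 : R),
      (fun k => t k ^+ 2 * dotr (w k) (w k)) @ \oo --> (0 : R),
      (fun k => t k ^+ 2 * dotr (f k) (f k)) @ \oo --> (0 : R)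
    & (fun k => t k ^+ 2 * dotr (g k) (g k)) @ \oo --> (0 : R)].
Proof.
move=> t r2 mu0 om0 omb rel rho0 hrho t00 Ew EV EV' Hmono Hanch Herr.
have b0 : 0 < b by lra.
have beta0 : 0 <= beta by lra.
pose eta := b + beta; pose m := (r - 2) * om.
have [K [c [t1 [K0 c0 Hdec]]]] := energy_decrease r2 mu0 om0 omb rel rho0 hrho.
have [t2 t20 Hlow] : exists2 t2 : R, 0 < t2 & forall t x V w e : R, t2 <= t ->
    om * r * t * (x * w + rho * w ^+ 2) <= energy r mu om b eta K t x V w e.
  by apply: energy_ge => //; rewrite /eta; lra.
pose E k := \sum_(i < p) energy r mu om b eta K (t k) (x k 0 i - xs 0 i)
  (V k 0 i) (w k 0 i) (e k 0 i).
pose Y k := \sum_(i < p) dissipation (t k) (x k.+1 0 i - x k 0 i) (w k.+1 0 i)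
  (f k 0 i) (g k 0 i) (e k 0 i) (e k.+1 0 i).
have tS k : t k.+1 = t k + 1 by rewrite /t -natr1 addrAC.
have t_gt0 k : 0 < t k by rewrite ltr_wpDl.
have Y0 k : 0 <= Y k.
  apply: sumr_ge0 => i _; rewrite /dissipation; have := t_gt0 k => tk.
  by rewrite addr_ge0 ?mulr_ge0 ?addr_ge0 ?sqr_ge0// ltW.
have anch k : 0 <= \sum_(i < p) ((x k 0 i - xs 0 i) * w k 0 i
                                 + rho * w k 0 i ^+ 2).
  have := Hanch k; rewrite /dotr mulr_sumr -big_split/=.
  by congr (0 <= _); apply: eq_bigr => i _; rewrite !mxE expr2.
pose h k i := g k 0 i + e k 0 i - f k 0 i.
have Ewi k i : w k 0 i = w k.+1 0 i - h k i by rewrite Ew !mxE.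
have EVi k i : V k 0 i = t k * (x k.+1 0 i - x k 0 i + b * w k.+1 0 i
    + (b * f k 0 i + beta * g k 0 i)) by rewrite EV !mxE.
pose v k i := (r + mu) * (x k.+1 0 i - x k 0 i) + m * (w k.+1 0 i + e k.+1 0 i).
have EV'i k i : V k.+1 0 i = V k 0 i - v k i by rewrite EV' !mxE.
have mono k : 0 <= \sum_(i < p) (h k i * (x k.+1 0 i - x k 0 i)
                                 + rho * h k i ^+ 2).
  have Eh i : w k.+1 0 i - w k 0 i = h k i by rewrite (Ewi k); ring.
  have := Hmono k; rewrite /dotr mulr_sumr -big_split/=.
  by congr (0 <= _); apply: eq_bigr => i _; rewrite !mxE Eh expr2.
have err k : 0 <= \sum_(i < p)
    ((g k 0 i + (r - 1) / t k * (w k.+1 0 i + f k 0 i - g k 0 i)) ^+ 2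
     - 4 * f k 0 i ^+ 2 - 18 * e k.+1 0 i ^+ 2).
  have := Herr k; rewrite -subr_ge0 /= /dotr !mulr_sumr opprD addrA -!sumrB.
  by congr (0 <= _); apply: eq_bigr => i _; rewrite !mxE !expr2.
have E0 : \forall k \near \oo, 0 <= E k.
  near=> k.
  have tk : t2 <= t k by near: k; exact: near_infty_shift_ge.
  apply: le_trans (_ : om * r * t k * \sum_(i < p)
    ((x k 0 i - xs 0 i) * w k 0 i + rho * w k 0 i ^+ 2) <= _).
    by do !apply: mulr_ge0 => //; lra.
  by rewrite mulr_sumr; apply: ler_sum => i _; exact: Hlow.
have ED : \forall k \near \oo, E k.+1 + c * Y k <= E k.
  near=> k.
  have tk : t1 <= t k by near: k; exact: near_infty_shift_ge.
  have := @ler_sum _ _ (index_enum 'I_p) xpredT _ _ (fun i _ =>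
    @Hdec (t k) (x k.+1 0 i - xs 0 i) (x k.+1 0 i - x k 0 i) (w k.+1 0 i)
      (f k 0 i) (g k 0 i) (e k 0 i) (e k.+1 0 i) eta m (h k i) _
      (V k 0 i) (v k i) tk erefl erefl erefl erefl (EVi k i) erefl).
  rewrite 4!big_split/= -!mulr_sumr.
  set E1 := (X in X + _ + _ + _ + _ <= _); set E2 := (X in _ <= X).
  have -> : E1 = E k.+1.
    by apply: eq_bigr => i _; rewrite -tS EV'i.
  have -> : E2 = E k.
    apply: eq_bigr => i _; rewrite -Ewi; congr energy; ring.
  apply: le_trans; rewrite lerD2r -!addrA lerDl.
  have ometa : 0 <= om * eta by rewrite mulr_ge0 /eta; lra.
  have omt : 0 <= om * t k ^+ 2 by rewrite mulr_ge0 ?sqr_ge0 ?ltW.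
  have rm : 0 <= r * m by rewrite /m; apply: mulr_ge0; [|apply: mulr_ge0]; lra.
  do !apply: addr_ge0; first exact: mulr_ge0.
    exact: mulr_ge0.
  by apply: mulr_ge0 => //; apply: mulr_ge0; rewrite ?sqr_ge0//; lra.
have cY : cvgn (series Y).
  have : cvgn (series (fun k => c * Y k)).
    apply: cvg_series_of_decrease E0 _ ED.
    by apply: nearW => k; rewrite mulr_ge0// ltW.
  move=> /(@is_cvg_seriesZ _ _ c^-1).
  suff -> : c^-1 *: (fun k => c * Y k) = Y by [].
  by apply/funext => k; rewrite [LHS]mulKf// gt_eqF.
have cCY C : cvgn (series (fun k => C * Y k)).
  by have := @is_cvg_seriesZ _ _ C cY.
have Y_0 : Y @ \oo --> (0 : R) by exact: cvg_series_cvg_0.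
have t_ge1 : \forall k \near \oo, 1 <= t k by exact: near_infty_shift_ge.
have V_0 : (fun k => dotr (V k) (V k)) @ \oo --> (0 : R).
  have [C C0 HC] := velocity_variation b beta (r + mu) m.
  apply: (@quasi_nondecreasing_cvg0 _ t0 _ (fun k => C * Y k)) => //.
  - near=> k; have tk : 1 <= t k by near: k.
    rewrite /dotr /Y mulr_sumr -big_split/=; apply: ler_sum => i _.
    by have [+ _] := HC _ (x k.+1 0 i - x k 0 i) (w k.+1 0 i) (f k 0 i) (g k 0 i)
      (e k 0 i) (e k.+1 0 i) _ _ tk (EVi k i) erefl; rewrite EV'i.
  - near=> k; have tk : 1 <= t k by near: k.
    rewrite ger0_norm; last by apply: sumr_ge0 => i _; rewrite -expr2 sqr_ge0.
    rewrite /dotr /Y !mulr_sumr; apply: ler_sum => i _.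
    by have [] := HC _ (x k.+1 0 i - x k 0 i) (w k.+1 0 i) (f k 0 i) (g k 0 i)
      (e k 0 i) (e k.+1 0 i) _ _ tk (EVi k i) erefl.
have tsq_le (q : nat -> 'rV[R]_p) : (forall k i, t k ^+ 2 * q k 0 i ^+ 2 <=
    dissipation (t k) (x k.+1 0 i - x k 0 i) (w k.+1 0 i)
      (f k 0 i) (g k 0 i) (e k 0 i) (e k.+1 0 i)) ->
    (fun k => t k ^+ 2 * dotr (q k) (q k)) @ \oo --> (0 : R).
  move=> Hq; apply: (squeeze_cvgr _ (cvg_cst 0) Y_0); apply: nearW => k.
  rewrite /dotr mulr_sumr; apply/andP; split.
    by apply: sumr_ge0 => i _; rewrite -expr2 mulr_ge0 ?sqr_ge0.
  by apply: ler_sum => i _; rewrite -expr2.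
have fast_le k i q : q \in [:: f k 0 i; g k 0 i] -> t k ^+ 2 * q ^+ 2 <=
    dissipation (t k) (x k.+1 0 i - x k 0 i) (w k.+1 0 i)
      (f k 0 i) (g k 0 i) (e k 0 i) (e k.+1 0 i).
  move=> qfg; rewrite /dissipation -[leLHS]addr0 lerD//; last first.
    by rewrite mulr_ge0 ?(ltW (t_gt0 k))// addr_ge0 ?sqr_ge0.
  rewrite ler_wpM2l ?sqr_ge0//.
  have := sqr_ge0 (f k 0 i); have := sqr_ge0 (g k 0 i).
  have := sqr_ge0 (e k 0 i); have := sqr_ge0 (e k.+1 0 i).
  by move: qfg; rewrite !inE; clear => /orP[] /eqP-> *; lra.
split => //.
- pose S k := \sum_(i < p) coupling b (t k) (V k 0 i) (w k 0 i).
  have S_0 : S @ \oo --> (0 : R).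
    have [C C0 HC] := coupling_variation (r + mu) m b0 beta0 hrho.
    apply: (@quasi_nondecreasing_cvg0 _ t0 _ (fun k => C * Y k)) => //.
    + near=> k; have tk : 1 <= t k by near: k.
      have := mulr_ge0 (sqr_ge0 (t k)) (mono k).
      rewrite -(lerDl (S k)) => /le_trans; apply.
      rewrite /S /Y !mulr_sumr -!big_split/=; apply: ler_sum => i _.
      have [+ _] := HC _ (x k.+1 0 i - x k 0 i) (w k.+1 0 i) (f k 0 i) (g k 0 i)
        (e k 0 i) (e k.+1 0 i) _ _ _ tk erefl (EVi k i) erefl.
      by rewrite EV'i (Ewi k) tS.
    + near=> k; have tk : 1 <= t k by near: k.
      apply: le_trans (ler_norm_sum _ _ _) _.
      rewrite /Y !mulr_sumr; apply: ler_sum => i _.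
      have [_] := HC _ (x k.+1 0 i - x k 0 i) (w k.+1 0 i) (f k 0 i) (g k 0 i)
        (e k 0 i) (e k.+1 0 i) _ _ _ tk erefl (EVi k i) erefl.
      by rewrite (Ewi k).
  (* t <w, V> <= b t^2 |w|^2 / 4 + |V|^2 / b *)
  apply: (squeeze_cvgr _ (cvg_cst 0)
    (_ : (fun k => 4 / b ^+ 2 * dotr (V k) (V k) - 4 / b * S k) @ \oo --> 0)).
    apply: nearW => k; rewrite mulr_ge0 ?sqr_ge0//=; last first.
      by apply: sumr_ge0 => i _; rewrite -expr2 sqr_ge0.
    rewrite /dotr /S !mulr_sumr -sumrB; apply: ler_sum => i _.
    rewrite /coupling -subr_ge0; set rhs := (X in 0 <= X).
    have -> : rhs = (2 / b * V k 0 i - t k * w k 0 i) ^+ 2.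
      by rewrite /rhs; field; rewrite gt_eqF.
    exact: sqr_ge0.
  rewrite -(subr0 0); apply: cvgB; exact: cvg0_scale.
- by apply: tsq_le => k i; apply: fast_le; rewrite !inE eqxx.
- by apply: tsq_le => k i; apply: fast_le; rewrite !inE eqxx orbT.
Unshelve. all: by end_near. Qed.

(** * Inner products and sequences of order o(1/t) *)

Lemma dotr_ge0 (R : realType) (p : nat) (u : 'rV[R]_p) : 0 <= dotr u u.
Proof. by apply: sumr_ge0 => i _; rewrite -expr2 sqr_ge0. Qed.

Lemma enorm_sqr (R : realType) (p : nat) (u : 'rV[R]_p) :
  enorm u ^+ 2 = dotr u u.
Proof. by rewrite sqr_sqrtr ?dotr_ge0. Qed.

Lemma dotrZZ (R : realType) (p : nat) (c : R) (u : 'rV[R]_p) :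
  dotr (c *: u) (c *: u) = c ^+ 2 * dotr u u.
Proof.
by rewrite /dotr mulr_sumr; apply: eq_bigr => i _; rewrite !mxE mulrACA.
Qed.

Lemma dotrDD_le (R : realType) (p : nat) (u v : 'rV[R]_p) :
  dotr (u + v) (u + v) <= 2 * dotr u u + 2 * dotr v v.
Proof.
rewrite /dotr !mulr_sumr -big_split; apply: ler_sum => i _ /=; rewrite !mxE.
by have := sqr_ge0 (u 0 i - v 0 i); lra.
Qed.

(** The norm of v k is o(1 / t k). *)
Definition negligible (R : realType) (p : nat) (t : nat -> R)
    (v : nat -> 'rV[R]_p) : Prop :=
  (fun k => t k ^+ 2 * dotr (v k) (v k)) @ \oo --> (0 : R).

Lemma negligible_le (R : realType) (p q : nat) (t s : nat -> R)
    (v : nat -> 'rV[R]_p) (w : nat -> 'rV[R]_q) (C : R) :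
  (forall k, s k ^+ 2 * dotr (w k) (w k) <= C * (t k ^+ 2 * dotr (v k) (v k))) ->
  negligible t v -> negligible s w.
Proof.
move=> le_wv v0; apply: (squeeze_cvgr _ (cvg_cst 0) (cvg0_scale C v0)).
by apply: nearW => k; rewrite le_wv mulr_ge0 ?sqr_ge0 ?dotr_ge0.
Qed.

Lemma negligibleD (R : realType) (p : nat) (t : nat -> R)
    (v w : nat -> 'rV[R]_p) :
  negligible t v -> negligible t w -> negligible t (fun k => v k + w k).
Proof.
move=> v0 w0.
have vw0 : (fun k => 2 * (t k ^+ 2 * dotr (v k) (v k))
    + 2 * (t k ^+ 2 * dotr (w k) (w k))) @ \oo --> (0 : R).
  by rewrite -(addr0 0); apply: cvgD; exact: cvg0_scale.
apply: (squeeze_cvgr _ (cvg_cst 0) vw0); apply: nearW => k.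
rewrite mulr_ge0 ?sqr_ge0 ?dotr_ge0//=.
have -> : 2 * (t k ^+ 2 * dotr (v k) (v k)) + 2 * (t k ^+ 2 * dotr (w k) (w k))
  = t k ^+ 2 * (2 * dotr (v k) (v k) + 2 * dotr (w k) (w k)) by ring.
by rewrite ler_wpM2l ?sqr_ge0 ?dotrDD_le.
Qed.

Lemma negligibleZ (R : realType) (p : nat) (t c : nat -> R) (C : R)
    (v : nat -> 'rV[R]_p) :
  (forall k, c k ^+ 2 <= C) -> negligible t v ->
  negligible t (fun k => c k *: v k).
Proof.
move=> cC; apply: (negligible_le (C := C)) => k.
by rewrite dotrZZ mulrCA ler_wpM2r// mulr_ge0 ?sqr_ge0 ?dotr_ge0.
Qed.

(** * Parameters of the scheme *)

Lemma t0_par_ge (R : realType) (rho r mu eta beta epsh : R) :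
  r <= t0_par rho r mu eta beta epsh.
Proof. by rewrite /t0_par !big_cons !le_max lexx !orbT. Qed.

(** The bound s < Psi means s^2 S <= B^2, where S is the radicand in Psi and B the
    bracket; as 0 < B <= 1 - 18 kappah this gives s^2 S <= B <= 1 - 18 kappah,
    and r > 2 yields S >= 4 + 18 kappa. For s = L eta the conclusion is the
    error estimate 4 |f|^2 + 18 |e'|^2 <= |d|^2. *)
Lemma Psi_par_bounds (R : realType) (r epsh kappa kappah : R) :
  2 < r -> 0 <= epsh -> 0 <= kappa -> 0 <= kappah ->
  kappah < (3 * r - 1) / (3 * r * (12 + 3 * r + epsh)) ->
  let Psi := Psi_par r epsh kappa kappah in
  0 < Psi <= 1 /\
  forall s, 0 <= s -> s < Psi -> (4 + 18 * kappa) * s ^+ 2 + 18 * kappah <= 1.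
Proof.
move=> r2 eps0 k0 kh0 kh Psi.
have kr : 0 <= kappa * r by apply: mulr_ge0 => //; lra.
have ke : 0 <= kappa * epsh by exact: mulr_ge0.
pose S := 4 + 12 * kappa + 3 * kappa * r + kappa * epsh.
have S4 : 4 <= S by rewrite /S; lra.
pose B := 1 - 1 / (3 * r) - kappah * (12 + 3 * r + epsh).
have B0 : 0 < B.
  have : kappah * (12 + 3 * r + epsh) < 1 - 1 / (3 * r).
    have -> : 1 - 1 / (3 * r) = (3 * r - 1) / (3 * r).
      by field; rewrite gt_eqF//; lra.
    rewrite -ltr_pdivlMr; last by lra.
    by rewrite -mulrA -invfM.
  by rewrite /B; lra.
have khr : 18 * kappah <= kappah * (12 + 3 * r + epsh).
  by rewrite mulrC ler_wpM2l//; lra.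
have ri : 0 <= 1 / (3 * r) by apply: divr_ge0; lra.
have B1 : B <= 1 - 18 * kappah by rewrite /B; lra.
have sq1 : 1 <= Num.sqrt S by rewrite -[leLHS]sqrtr1 ler_wsqrtr//; lra.
have sq0 : 0 < Num.sqrt S by lra.
have EPsi : Psi = B / Num.sqrt S by rewrite /Psi /Psi_par mul1r mulrC.
have Psi0 : 0 < Psi by rewrite EPsi divr_gt0.
split.
  by rewrite Psi0/= EPsi ler_pdivrMr// mul1r; lra.
move=> s s0 sP.
have s2 : s ^+ 2 * S <= B ^+ 2.
  have -> : B ^+ 2 = Psi ^+ 2 * S.
    by rewrite EPsi expr_div_n sqr_sqrtr ?divfK// ?gt_eqF//; lra.
  rewrite ler_wpM2r//; first by lra.
  by rewrite ler_sqr ?nnegrE// ltW.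
have B2 : B ^+ 2 <= B.
  by rewrite expr2 ler_piMr//; lra.
have : (4 + 18 * kappa) * s ^+ 2 <= s ^+ 2 * S.
  rewrite mulrC ler_wpM2l ?sqr_ge0// /S.
  have : 0 <= kappa * (r - 2) by apply: mulr_ge0; lra.
  by lra.
by lra.
Qed.

Lemma step_size_bound (R : realType) (L eta Psi : R) :
  0 <= L -> 0 < Psi -> (eta%:E < Psi%:E / L%:E)%E -> L * eta < Psi.
Proof.
rewrite le_eqVlt => /orP[/eqP <-|L0] P0; first by rewrite mul0r.
by rewrite inver gt_eqF// lte_fin ltr_pdivlMr// mulrC.
Qed.

(** * The accelerated extragradient scheme *)

Theorem theorem7p5 (R : realType) (p : nat)
    (F : 'rV[R]_p -> 'rV[R]_p) (T : 'rV[R]_p -> set 'rV[R]_p)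
    (L rho r mu eps epsh kappa kappah eta : R)
    (x y xi u : nat -> 'rV[R]_p) :
  let Psi := Psi_par r epsh kappa kappah in
  let beta := 8 * rho + 2 * eps in
  let t := fun k : nat => k%:R + t0_par rho r mu eta beta epsh in
  zer (add_op F T) !=set0 ->
  0 <= rho -> cohypomonotone rho (add_op F T) ->
  0 <= L -> lipschitz_with L F ->
  2 < r -> 1 < mu -> 0 <= eps -> 0 <= epsh -> 0 <= kappa ->
  0 <= kappah -> kappah < (3 * r - 1) / (3 * r * (12 + 3 * r + epsh)) ->
  L * rho < (r - 2) * Psi / (8 * (r + mu - 1)) ->
  beta < eta ->
  (r + mu - 1) * beta / (r - 2) <= eta ->
  (eta%:E < Psi%:E / L%:E)%E ->
  resolvent_total_single_valued eta T ->
  gaeg_plus F T r mu eta beta t x y xi u ->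
  (forall k : nat, (1 <= k)%N ->
    enorm (F (x k) - u k) ^+ 2
    <= kappa * enorm (F (x k) - F (y_prev y k)) ^+ 2
       + kappah * enorm (d_prev F r t y xi u k) ^+ 2) ->
  [/\ 0 < Psi <= 1,
      (fun k : nat => k%:R ^+ 2 * enorm (F (x k) + xi k) ^+ 2) @ \oo
        --> (0 : R),
      (fun k : nat => k%:R ^+ 2 * enorm (x k.+1 - x k) ^+ 2) @ \oo
        --> (0 : R)
    & (fun k : nat => k%:R ^+ 2 * enorm (y k - x k) ^+ 2) @ \oo
        --> (0 : R)].
Proof.
move=> Psi beta t [xs zs] rho0 cohypo L0 lip r2 mu1 eps0 epsh0 k0 kh0 kh _.
move=> betaeta _ etaL _ S Herr.
have [PsiP PsiS] := Psi_par_bounds r2 epsh0 k0 kh0 kh.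
have etaPsi : L * eta < Psi by apply: step_size_bound etaL => //; case/andP: PsiP.
have beta0 : 0 <= beta by rewrite /beta; lra.
have eta0 : 0 < eta by lra.
have etan : eta != 0 by rewrite gt_eqF.
have hrho : 8 * rho <= beta by rewrite /beta; lra.
pose t0 := t0_par rho r mu eta beta epsh.
have t0r : r <= t0 by exact: t0_par_ge.
have t_gt0 k : 0 < t k by rewrite /t -/t0 ltr_wpDl//; lra.
have tS k : t k.+1 = t k + 1 by rewrite /t -natr1 addrAC.
pose b := eta - beta; pose om := omega_par mu eta beta.
have mu0 : 0 < mu by lra.
have b0 : 0 < b by rewrite /b; lra.
have om0 : 0 < om by rewrite /om /omega_par divr_gt0 ?mulr_gt0//; lra.
have rel : (mu + 1) * om = mu * b.
  by rewrite /om /omega_par -/b; field; rewrite gt_eqF//; lra.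
have omb : om < b.
  have : 0 < (mu + 1) * (b - om) by rewrite mulrBr rel; lra.
  by rewrite pmulr_rgt0; lra.
pose w k := F (x k) + xi k.
pose e k := u k - F (x k).
pose f k := F (y k) - F (x k.+1).
pose z k := u k + xi k.
pose g k := F (y k) + xi k.+1 - z k.
pose V k := t k *: (x k.+1 - x k + b *: w k.+1 + (b *: f k + beta *: g k)).
have Ez k : z k = w k.+1 + f k - g k.
  by apply/rowP => i; rewrite !mxE; ring.
have Ed k : d_ F r t y xi u k = g k + ((r - 1) / t k) *: z k.
  apply/rowP => i; rewrite !mxE /gamma_ /=; field.
  by rewrite gt_eqF.
have inT := gaeg_xi_in etan S.
have inPhi k : add_op F T (x k) (w k) by exists (xi k).
have xstep := gaeg_stepE etan S.
(* The parameters of the scheme are designed for this recurrence. *)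
have EV' k : V k.+1 = V k - ((r + mu) *: (x k.+1 - x k)
    + ((r - 2) * om) *: (w k.+1 + e k.+1)).
  apply/rowP => i.
  have := congr1 (fun v : 'rV_p => v 0 i) (xstep k.+1).
  have := congr1 (fun v : 'rV_p => v 0 i) (gaeg_y S k).
  rewrite !mxE /gamma_ /theta_ /eta_ /lambda_ /nu_ /delta_par /= tS => Hy Hx.
  rewrite Hx Hy /om /omega_par /b; field.
  by have tk := t_gt0 k; rewrite !gt_eqF//; lra.
have Ew k : w k = w k.+1 - (g k + e k - f k).
  by apply/rowP => i; rewrite !mxE; ring.
have mono k : 0 <= dotr (w k.+1 - w k) (x k.+1 - x k)
                  + rho * dotr (w k.+1 - w k) (w k.+1 - w k).
  by have := cohypo _ _ _ _ (inPhi k.+1) (inPhi k); rewrite enorm_sqr; lra.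
have anch k : 0 <= dotr (x k - xs) (w k) + rho * dotr (w k) (w k).
  have := cohypo _ _ _ _ (inPhi k) zs; rewrite enorm_sqr subr0.
  have -> : dotr (w k) (x k - xs) = dotr (x k - xs) (w k).
    by apply: eq_bigr => i _; rewrite mulrC.
  by lra.
have dotrC2 (v v' : 'rV[R]_p) : dotr (v - v') (v - v') = dotr (v' - v) (v' - v).
  by apply: eq_bigr => i _; rewrite !mxE -mulrNN !opprB.
have err k : 4 * dotr (f k) (f k) + 18 * dotr (e k.+1) (e k.+1)
    <= let d := g k + ((r - 1) / t k) *: (w k.+1 + f k - g k) in dotr d d.
  rewrite -Ez -Ed /=.
  have := Herr k.+1 isT; rewrite !enorm_sqr /= dotrC2 -/(e k.+1) dotrC2 -/(f k).
  set d := d_ _ _ _ _ _ _ _ => He.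
  have Hf : dotr (f k) (f k) <= (L * eta) ^+ 2 * dotr d d.
    rewrite exprMn -mulrA -dotrZZ.
    have -> : eta *: d = y k - x k.+1 by rewrite xstep subKr.
    have := lip (y k) (x k.+1); rewrite -!enorm_sqr -exprMn.
    by rewrite ler_sqr ?nnegrE ?mulr_ge0 ?sqrtr_ge0.
  have Le0 : 0 <= L * eta by apply: mulr_ge0 => //; exact: ltW.
  have dd := dotr_ge0 d.
  have := PsiS _ Le0 etaPsi => C1.
  have J1 : ((4 + 18 * kappa) * (L * eta) ^+ 2 + 18 * kappah) * dotr d d <= dotr d d.
    by rewrite ler_piMl.
  have J2 : (4 + 18 * kappa) * dotr (f k) (f k)
      <= (4 + 18 * kappa) * ((L * eta) ^+ 2 * dotr d d).
    by rewrite ler_wpM2l//; lra.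
  by lra.
have t00 : 0 < t0 by lra.
have [V_0 w_0 f_0 g_0] := @flow_asymptotics R p r mu om b beta rho t0 xs x V w f g e
  r2 mu0 om0 omb rel rho0 hrho t00 Ew (fun=> erefl) EV' mono anch err.
rewrite -/(negligible t w) in w_0.
rewrite -/(negligible t f) in f_0.
rewrite -/(negligible t g) in g_0.
(* Both remaining sequences are combinations of V, w and the fast errors. *)
have w1_0 : negligible t (fun k => w k.+1).
  have : negligible (fun k => t k.+1) (fun k => w k.+1).
    by have := w_0; rewrite /negligible -(cvg_shiftS (fun k => _)).
  apply: (negligible_le (C := 1)) => k; rewrite mul1r ler_wpM2r ?dotr_ge0//.
  have tk := ltW (t_gt0 k).
  by rewrite tS ler_sqr ?nnegrE; clear - tk; lra.
have cZ (c : R) v : negligible t v -> negligible t (fun k => c *: v k).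
  by apply: (@negligibleZ _ _ _ (fun=> c) (c ^+ 2)).
have x_0 : negligible t (fun k => x k.+1 - x k).
  have Vt : negligible t (fun k => (t k)^-1 *: V k).
    rewrite /negligible; under eq_fun do
      rewrite dotrZZ mulrA -exprMn divff ?expr1n ?mul1r ?gt_eqF//.
    exact: V_0.
  have -> : (fun k => x k.+1 - x k) = (fun k => (t k)^-1 *: V k
    + ((- b) *: w k.+1 + ((- b) *: f k + (- beta) *: g k))).
    apply/funext => k; rewrite /V scalerA mulVf ?gt_eqF// scale1r.
    by apply/rowP => i; rewrite !mxE; ring.
  by do !apply: negligibleD => //; exact: cZ.
have z_0 : negligible t z.
  have -> : z = (fun k => w k.+1 + (f k + (-1) *: g k)).
    by apply/funext => k; apply/rowP => i; rewrite !mxE; ring.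
  by do !apply: negligibleD => //; exact: cZ.
have d_0 : negligible t (fun k => g k + ((r - 1) / t k) *: z k).
  apply: negligibleD => //; apply: (negligibleZ (C := (r - 1) ^+ 2)) z_0 => k.
  have tk1 : 1 <= t k by rewrite /t -/t0; have := ler0n R k; lra.
  rewrite expr_div_n ler_pdivrMr ?exprn_gt0//.
  by rewrite ler_peMr ?sqr_ge0// exprn_ege1.
have y_0 : negligible t (fun k => y k - x k).
  have -> : (fun k => y k - x k) = (fun k => (x k.+1 - x k)
      + eta *: (g k + ((r - 1) / t k) *: z k)).
    apply/funext => k; rewrite [in RHS]xstep Ed.
    by apply/rowP => i; rewrite !mxE; ring.
  by apply: negligibleD => //; exact: cZ d_0.
have fin (v : nat -> 'rV[R]_p) : negligible t v ->
    (fun k : nat => k%:R ^+ 2 * enorm (v k) ^+ 2) @ \oo --> (0 : R).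
  move=> v0; under eq_fun do rewrite enorm_sqr.
  apply: (@negligible_le _ p p t _ v v 1) v0 => k.
  rewrite mul1r ler_wpM2r ?dotr_ge0//.
  have kt : k%:R <= t k by rewrite /t -/t0 lerDl ltW.
  by rewrite ler_sqr ?nnegrE ?ler0n//; exact: ltW (t_gt0 k).
by split => //; apply: fin.
Qed.
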